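(* Let $\mathbb{C}\{x_1,\dots,x_n\}$ be the ring of convergent power series and let $0\ne f\in\langle x_1,\dots,x_n\rangle\lhd\mathbb{C}\{x_1,\dots,x_n\}$. Then the extended Jacobian ideal \[ \tilde{\mathcal J}_f=\left\langle \frac{\partial f}{\partial x_1},\dots,\frac{\partial f}{\partial x_n},f\right\rangle \] is a monomial ideal if and only if $f$ is right equivalent to a Thom--Sebastiani polynomial.
   Context: An ideal of $\mathbb{C}\{x_1,\dots,x_n\}$ is called monomial if it is generated by monomials in terms of some local coordinates (i.e. some regular system of parameters $y_1,\dots,y_n$ of $\mathbb{C}\{x_1,\dots,x_n\}$, equivalently the images of $x_1,\dots,x_n$ under some $\mathbb{C}$-algebra automorphism). Two power series $f,f'$ are right equivalent if $\varphi(f)=f'$ for some $\mathbb{C}$-algebra automorphism $\varphi$ of $\mathbb{C}\{x_1,\dots,x_n\}$. A Thom--Sebastiani polynomial is a nonzero sum of non-constant monomials in pairwise disjoint sets of variables, i.e. $\sum_{j=1}^k x^{\alpha_j}$ with $k\ge1$, $0\ne\alpha_j\in\mathbb{N}^n$ and the supports $\{i:(\alpha_j)_i\neq0\}$ pairwise disjoint. *)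

(* Defs.v *)
From HB Require Import structures.
From mathcomp Require Import all_boot all_order all_algebra.
From mathcomp Require Import reals complex.
Set Implicit Arguments. Unset Strict Implicit. Unset Printing Implicit Defensive.
Import Order.TTheory GRing.Theory Num.Theory.
Local Open Scope ring_scope.

Section PS.
Variables (R : realType) (n : nat).
Local Notation C := (R[i]).

Definition mi := {ffun 'I_n -> nat}.
Definition ps := mi -> C.

Definition mdegree (a : mi) : nat := (\sum_(i < n) a i)%N.

Definition mi_below (a : mi) : seq mi :=
  map (fun b : {ffun 'I_n -> 'I_(mdegree a).+1} => [ffun i => nat_of_ord (b i)] : mi)
    (filter (fun b : {ffun 'I_n -> 'I_(mdegree a).+1} => [forall i, (b i <= a i)%N])
       (enum {ffun 'I_n -> 'I_(mdegree a).+1})).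

Definition mi_sub (a b : mi) : mi := [ffun i => (a i - b i)%N].
Definition mi_add (a b : mi) : mi := [ffun i => (a i + b i)%N].
Definition mi_unit (i : 'I_n) : mi := [ffun j => (j == i : nat)].
Definition mi_zero : mi := [ffun=> 0%N].

Definition padd (f g : ps) : ps := fun a => f a + g a.
Definition pscale (c : C) (f : ps) : ps := fun a => c * f a.
Definition pmul (f g : ps) : ps :=
  fun a => \sum_(b <- mi_below a) f b * g (mi_sub a b).
Definition psum (k : nat) (F : 'I_k -> ps) : ps := fun a => \sum_(j < k) F j a.
Definition pzero : ps := fun=> 0.
Definition mono (b : mi) : ps := fun a => (a == b)%:R.
Definition pone : ps := mono mi_zero.
Definition pderiv (i : 'I_n) (f : ps) : ps :=
  fun a => (a i).+1%:R * f (mi_add a (mi_unit i)).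

Definition convergent (f : ps) : Prop :=
  exists r M : C, 0 < r /\ forall a, `|f a| * r ^+ mdegree a <= M.

Definition ideal_gen (G : ps -> Prop) (p : ps) : Prop :=
  exists (k : nat) (h g : 'I_k -> ps),
    (forall j, convergent (h j) /\ G (g j)) /\ p = psum (fun j => pmul (h j) (g j)).

Definition is_automorphism (phi : ps -> ps) : Prop :=
  (forall f, convergent f -> convergent (phi f)) /\
      (forall f g, convergent f -> convergent g -> phi (padd f g) = padd (phi f) (phi g)) /\
      (forall f g, convergent f -> convergent g -> phi (pmul f g) = pmul (phi f) (phi g)) /\
      (forall c f, convergent f -> phi (pscale c f) = pscale c (phi f)) /\
      phi pone = pone /\
      (forall f g, convergent f -> convergent g -> phi f = phi g -> f = g) /\
    (forall g, convergent g -> exists f, convergent f /\ phi f = g).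

(* monomial ideal: generated by monomials in some local coordinates
   y_i = phi(x_i), i.e. the image under an automorphism of an ideal generated
   by monomials x^b, b in S *)
Definition monomial_ideal (I : ps -> Prop) : Prop :=
  exists phi, is_automorphism phi /\ exists S : mi -> Prop,
    forall p, I p <-> exists q, ideal_gen (fun m => exists b, S b /\ m = mono b) q /\ p = phi q.

Definition right_equiv (f f' : ps) : Prop :=
  exists phi, is_automorphism phi /\ phi f = f'.

Definition mi_support (a : mi) : {set 'I_n} := [set i | (a i != 0)%N].

Definition thom_sebastiani (p : ps) : Prop :=
  exists (k : nat) (al : 'I_k -> mi),
    (0 < k)%N /\ (forall j, al j != mi_zero) /\
    (forall j j', j != j' -> [disjoint mi_support (al j) & mi_support (al j')]) /\
    p = psum (fun j => mono (al j)).

Definition ext_jacobian_ideal (f : ps) : ps -> Prop :=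
  ideal_gen (fun q => q = f \/ exists i, q = pderiv i f).

End PS.

(* Main.v *)
(* Let I be the extended Jacobian ideal of f, written in coordinates in which it is generated
   by the antichain of monomials x^b.  As every partial derivative of f lies in I, lowering any
   positive exponent of a monomial of f gives an element of I; hence f lies in m I, and by
   Nakayama I is generated by the partial derivatives, i.e. the constant matrix of the
   coefficients of the x^b in the d_i f has full column rank.  A nonzero maximal minor matches
   each b with its own variable i = sigma(b) such that x^(b + e_i) occurs in f, and an exchange
   argument shows that these exponents (with 2 e_i in place of b + e_sigma(b) if b = e_i) are
   pairwise equal or have disjoint supports: they define a Thom-Sebastiani polynomial p with the
   same ideal I.  Off finitely many t, the series f + t (p - f) still has Jacobian ideal I, so
   an arc from 0 to 1 avoids the bad t, and Moser's path method shows that the right equivalence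
   class is locally constant along it.  The flow needed there is not obtained by integrating a
   vector field but as a convergent Lie series of differential operators in t, which is
   directly an algebra automorphism. *)

Require Import Defs.
From HB Require Import structures.
From mathcomp Require Import all_boot all_order all_algebra fingroup perm.
From mathcomp Require Import boolp classical_sets reals complex.
From mathcomp Require Import zify ring lra.
Set Implicit Arguments. Unset Strict Implicit. Unset Printing Implicit Defensive.
Import Order.TTheory GRing.Theory Num.Theory.
Local Open Scope ring_scope.

(** * Power series as a ring *)

(** Automorphisms are abstract algebra maps, not substitutions of power series. A right equivalence
    must therefore come from a construction that is multiplicative by design, so the flow is solved
    coefficientwise in [t]; for the same reason the chain rule has to be derived from the derivation
    property alone. The obstacle is convergence: each derivative costs radius, and k derivatives
    sharing a fixed gap of radii cost about k^k. The divisor k + 1 in the recursion for the flow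
    compensates this if the gap is shared out suitably. Since the field vanishes at the origin, the
    bounds depend only on ratios of radii, so one small [t] serves all convergent series. The path
    stays under control by linearity: the series without constant term whose partial derivatives lie
    in I form a vector space. Along the segment from f to p only the rank of the constant matrix can
    drop, and this is governed by a polynomial in [t]. *)

Section MultiIndex.
Variable n : nat.
Implicit Types a b c : mi n.

Definition mi_le a b := [forall i, a i <= b i]%N.

Lemma mi_leP a b : reflect (forall i, a i <= b i)%N (mi_le a b).
Proof. exact: forallP. Qed.

Lemma mi_addE a b i : mi_add a b i = (a i + b i)%N. Proof. by rewrite ffunE. Qed.
Lemma mi_subE a b i : mi_sub a b i = (a i - b i)%N. Proof. by rewrite ffunE. Qed.
Lemma mi_unitE (i j : 'I_n) : mi_unit i j = (j == i) :> nat. Proof. by rewrite ffunE. Qed.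
Lemma mi_zeroE (i : 'I_n) : mi_zero n i = 0%N. Proof. by rewrite ffunE. Qed.
Definition miE := (mi_addE, mi_subE, mi_unitE, mi_zeroE).

Lemma mi_le_refl a : mi_le a a. Proof. exact/mi_leP. Qed.
Lemma mi_le_trans b a c : mi_le a b -> mi_le b c -> mi_le a c.
Proof. by move=> /mi_leP h /mi_leP k; apply/mi_leP => i; apply: leq_trans (k i). Qed.
Lemma mi_le_anti a b : mi_le a b -> mi_le b a -> a = b.
Proof.
move=> /mi_leP h /mi_leP k; apply/ffunP => i; apply/eqP.
by rewrite eqn_leq h k.
Qed.
Lemma mi_le0 a : mi_le (mi_zero n) a.
Proof. by apply/mi_leP => i; rewrite miE. Qed.
Lemma mi_le_add a b : mi_le a (mi_add a b).
Proof. by apply/mi_leP => i; rewrite miE leq_addr. Qed.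
Lemma mi_le_sub a b : mi_le (mi_sub a b) a.
Proof. by apply/mi_leP => i; rewrite miE leq_subr. Qed.

Lemma mi_addC a b : mi_add a b = mi_add b a.
Proof. by apply/ffunP => i; rewrite !miE addnC. Qed.
Lemma mi_add0 a : mi_add (mi_zero n) a = a.
Proof. by apply/ffunP => i; rewrite !miE. Qed.
Lemma mi_addK a b : mi_sub (mi_add a b) b = a.
Proof. by apply/ffunP => i; rewrite !miE addnK. Qed.
Lemma mi_addKl a b : mi_sub (mi_add a b) a = b.
Proof. by rewrite mi_addC mi_addK. Qed.
Lemma mi_subK a b : mi_le b a -> mi_add (mi_sub a b) b = a.
Proof. by move=> /mi_leP h; apply/ffunP => i; rewrite !miE subnK. Qed.
Lemma mi_subKr a b : mi_le b a -> mi_sub a (mi_sub a b) = b.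
Proof. by move=> /mi_leP h; apply/ffunP => i; rewrite !miE subKn. Qed.
Lemma mi_sub0 a : mi_sub a (mi_zero n) = a.
Proof. by apply/ffunP => i; rewrite !miE subn0. Qed.
Lemma mi_addI a : injective (mi_add a).
Proof. by move=> b c h; rewrite -(mi_addKl a b) h mi_addKl. Qed.

Lemma mdegD a b : mdegree (mi_add a b) = (mdegree a + mdegree b)%N.
Proof. by rewrite /mdegree -big_split; apply: eq_bigr => i _; rewrite miE. Qed.
Lemma mdeg0 : mdegree (mi_zero n) = 0%N.
Proof. by rewrite /mdegree big1// => i _; rewrite miE. Qed.
Lemma mdegU (i : 'I_n) : mdegree (mi_unit i) = 1%N.
Proof.
rewrite /mdegree (bigD1 i)//= miE eqxx big1// => j /negPf h.
by rewrite miE h.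
Qed.
Lemma mdeg_eq0 a : mdegree a = 0%N -> a = mi_zero n.
Proof.
move=> /eqP; rewrite sum_nat_eq0 => /forallP h; apply/ffunP => i.
by rewrite miE; apply/eqP; have := h i.
Qed.
Lemma mi_le_deg a b : mi_le a b -> (mdegree a <= mdegree b)%N.
Proof. by move=> h; rewrite -(mi_subK h) mdegD leq_addl. Qed.
Lemma mi_le_eqdeg a b : mi_le a b -> (mdegree b <= mdegree a)%N -> a = b.
Proof.
move=> h; rewrite -[in X in X -> _](mi_subK h) mdegD => k.
by rewrite -(mi_subK h) [mi_sub b a]mdeg_eq0 ?mi_add0//; lia.
Qed.
Lemma mi_leU i a : mi_le (mi_unit i) a = (0 < a i)%N.
Proof.
apply/mi_leP/idP => [/(_ i)|h j]; first by rewrite miE eqxx.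
by rewrite miE; case: eqP => [->|].
Qed.
Lemma mi_neq0P a : a != mi_zero n -> exists i, (0 < a i)%N.
Proof.
move=> h; apply/existsP; apply: contraNT h => /existsPn h.
by apply/eqP/ffunP => i; rewrite miE; have := h i; rewrite -eqn0Ngt => /eqP.
Qed.
Lemma coord_le_deg a i : (a i <= mdegree a)%N.
Proof. by rewrite /mdegree (bigD1 i)//= leq_addr. Qed.

Lemma mem_below a b : (b \in mi_below a) = mi_le b a.
Proof.
apply/mapP/idP => [[c]|/mi_leP h].
  rewrite mem_filter => /andP[/forallP h _] ->.
  by apply/mi_leP => i; rewrite ffunE.
have hd i : (b i < (mdegree a).+1)%N by rewrite ltnS (leq_trans (h i))// coord_le_deg.
exists [ffun i => Ordinal (hd i)].
  rewrite mem_filter; apply/andP; split; last by rewrite mem_enum.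
  by apply/forallP => i; rewrite ffunE; apply: h.
by apply/ffunP => i; rewrite !ffunE.
Qed.

Lemma uniq_below a : uniq (mi_below a).
Proof.
rewrite map_inj_uniq; first by apply: filter_uniq; apply: enum_uniq.
move=> b c /ffunP h; by apply/ffunP => i; apply/val_inj; have := h i; rewrite !ffunE.
Qed.

#[local] Opaque mi_below.

Lemma below0 : perm_eq (mi_below (mi_zero n)) [:: mi_zero n].
Proof.
apply: uniq_perm => [||b]; rewrite ?uniq_below// mem_below inE.
apply/idP/eqP => [h|->]; last exact: mi_le_refl.
exact: mi_le_anti (mi_le0 _).
Qed.

Lemma below_sub a : perm_eq (map (mi_sub a) (mi_below a)) (mi_below a).
Proof.
have inj : {in mi_below a &, injective (mi_sub a)}.
  move=> b c; rewrite !mem_below => hb hc h.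
  by rewrite -(mi_subKr hb) h mi_subKr.
apply: uniq_perm => [||b]; [by rewrite map_inj_in_uniq ?uniq_below | exact: uniq_below |].
rewrite mem_below; apply/mapP/idP => [[c _ ->]|h]; first exact: mi_le_sub.
by exists (mi_sub a b); rewrite ?mem_below ?mi_le_sub// mi_subKr.
Qed.

(** With [below_le], this presents intervals with a moved endpoint as filters of one fixed interval,
    the form in which double Cauchy sums can be exchanged. *)
Lemma below_ge a c : mi_le c a ->
  perm_eq (map (mi_add c) (mi_below (mi_sub a c))) [seq b <- mi_below a | mi_le c b].
Proof.
move=> hc; apply: uniq_perm => [||b].
- by rewrite map_inj_uniq ?uniq_below//; apply: mi_addI.
- by rewrite filter_uniq ?uniq_below.
rewrite mem_filter mem_below; apply/mapP/andP => [[d]|[h1 h2]].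
  rewrite mem_below => hd ->; split; first exact: mi_le_add.
  apply/mi_leP => i; move/mi_leP: hd => /(_ i); move/mi_leP: hc => /(_ i).
  by rewrite !miE; lia.
exists (mi_sub b c); last by rewrite mi_addC mi_subK.
rewrite mem_below; apply/mi_leP => i; rewrite !miE.
by move/mi_leP: h2 => /(_ i); lia.
Qed.

Lemma below_le a b : mi_le b a ->
  perm_eq (mi_below b) [seq c <- mi_below a | mi_le c b].
Proof.
move=> h; apply: uniq_perm; rewrite ?filter_uniq ?uniq_below// => c.
rewrite mem_filter !mem_below; case: (boolP (mi_le c b)) => //= k.
by rewrite (mi_le_trans k).
Qed.

End MultiIndex.

Arguments mi_zero {n}.

Section Ring.
Variables (R : realType) (n : nat).
Local Notation C := (R[i]).
Local Notation ps := (ps R n).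
Implicit Types (f g h : ps) (a b c : mi n).

Lemma psP f g : (forall a, f a = g a) -> f = g.
Proof. by move=> h; apply: functional_extensionality_dep. Qed.

HB.instance Definition _ := gen_eqMixin ps.
HB.instance Definition _ := gen_choiceMixin ps.

Definition popp f : ps := fun a => - f a.

Lemma paddA : associative (@padd R n).
Proof. by move=> f g h; apply: psP => a; rewrite /padd addrA. Qed.
Lemma paddC : commutative (@padd R n).
Proof. by move=> f g; apply: psP => a; rewrite /padd addrC. Qed.
Lemma padd0 : left_id (@pzero R n) (@padd R n).
Proof. by move=> f; apply: psP => a; rewrite /padd add0r. Qed.
Lemma paddN : left_inverse (@pzero R n) popp (@padd R n).
Proof. by move=> f; apply: psP => a; rewrite /padd addNr. Qed.

HB.instance Definition _ := GRing.isZmodule.Build ps paddA paddC padd0 paddN.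

Lemma pmulC : commutative (@pmul R n).
Proof.
move=> f g; apply: psP => a; rewrite /pmul.
rewrite -(perm_big _ (below_sub a))/= [LHS]big_map; apply: eq_big_seq => b.
by rewrite mem_below => h; rewrite mulrC mi_subKr.
Qed.

Lemma pmulA : associative (@pmul R n).
Proof.
move=> f g h; apply: psP => a; rewrite /pmul.
transitivity (\sum_(b <- mi_below a) \sum_(d <- mi_below (mi_sub a b))
    f b * g d * h (mi_sub a (mi_add b d))).
  apply: eq_big_seq => b _ /=; rewrite big_distrr /=; apply: eq_bigr => d _.
  by rewrite mulrA; congr (_ * h _); apply/ffunP => i; rewrite !miE subnDA.
transitivity (\sum_(c <- mi_below a) \sum_(b <- mi_below a | mi_le b c)
    f b * g (mi_sub c b) * h (mi_sub a c)).
  rewrite (exchange_big_dep xpredT)//=; apply: eq_big_seq => b.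
  rewrite mem_below => hb; rewrite -[RHS]big_filter.
  rewrite -(perm_big _ (below_ge hb)) [RHS]big_map /=; apply: eq_bigr => d _.
  by rewrite mi_addKl.
apply: eq_big_seq => b; rewrite mem_below => hb.
by rewrite mulr_suml (perm_big _ (below_le hb)) big_filter.
Qed.

Lemma pmul1 : left_id (@pone R n) (@pmul R n).
Proof.
move=> f; apply: psP => a; rewrite /pmul (bigD1_seq mi_zero) ?uniq_below//=; last first.
  by rewrite mem_below mi_le0.
rewrite /pone /mono eqxx mul1r mi_sub0 big1 ?addr0// => b /negPf ->.
by rewrite mul0r.
Qed.

Lemma pmulDl : left_distributive (@pmul R n) (@padd R n).
Proof.
move=> f g h; apply: psP => a; rewrite /pmul /padd -big_split.
by apply: eq_bigr => b _; rewrite mulrDl.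
Qed.

Lemma pone_neq0 : @pone R n != @pzero R n.
Proof.
apply/eqP => /(congr1 (fun f : ps => f mi_zero)) /eqP.
by rewrite /pone /mono /pzero eqxx oner_eq0.
Qed.

HB.instance Definition _ :=
  GRing.Zmodule_isComNzRing.Build ps pmulA pmulC pmul1 pmulDl pone_neq0.

Lemma pcoefD f g a : (f + g) a = f a + g a. Proof. by []. Qed.
Lemma pcoefN f a : (- f) a = - f a. Proof. by []. Qed.
Lemma pcoefB f g a : (f - g) a = f a - g a. Proof. by []. Qed.
Lemma pcoefM f g a : (f * g) a = \sum_(b <- mi_below a) f b * g (mi_sub a b).
Proof. by []. Qed.
Lemma pcoef1 a : (1 : ps) a = (a == mi_zero)%:R. Proof. by []. Qed.
Lemma pcoef_sum (I : Type) (s : seq I) (P : pred I) (F : I -> ps) a :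
  (\sum_(i <- s | P i) F i) a = \sum_(i <- s | P i) F i a.
Proof. by elim/big_rec2: _ => // i x y _ <-. Qed.

Lemma psumE k (F : 'I_k -> ps) : psum F = \sum_j F j.
Proof. by apply: psP => a; rewrite pcoef_sum. Qed.

Lemma pcoefM0 f g : (f * g) mi_zero = f mi_zero * g mi_zero.
Proof. by rewrite pcoefM (perm_big _ (below0 n)) big_seq1 mi_sub0. Qed.

(* The [C]-algebra structure is kept as multiplication by a constant series. *)
Definition pC (c : C) : ps := pscale c 1.

Lemma pscaleE (c : C) f : pscale c f = pC c * f.
Proof.
apply: psP => a; rewrite pcoefM (bigD1_seq mi_zero) ?uniq_below//=; last first.
  by rewrite mem_below mi_le0.
rewrite /pC /pscale pcoef1 eqxx mulr1 mi_sub0 big1 ?addr0// => b /negPf h.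
by rewrite pcoef1 h mulr0 mul0r.
Qed.
Lemma pcoefCM (c : C) f a : (pC c * f) a = c * f a.
Proof. by rewrite -pscaleE. Qed.
Lemma pcoefC (c : C) a : pC c a = c * (a == mi_zero)%:R. Proof. by []. Qed.
Lemma pCD (c d : C) : pC (c + d) = pC c + pC d.
Proof. by apply: psP => a; rewrite pcoefD !pcoefC mulrDl. Qed.
Lemma pCN (c : C) : pC (- c) = - pC c.
Proof. by apply: psP => a; rewrite pcoefN !pcoefC mulNr. Qed.
Lemma pCM (c d : C) : pC (c * d) = pC c * pC d.
Proof. by apply: psP => a; rewrite pcoefCM !pcoefC mulrA. Qed.
Lemma pC1 : pC 1 = 1.
Proof. by apply: psP => a; rewrite pcoefC mul1r. Qed.
Lemma pC0 : pC 0 = 0.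
Proof. by apply: psP => a; rewrite pcoefC mul0r. Qed.
Fact pC_zmod : zmod_morphism pC.
Proof. by move=> c d; rewrite pCD pCN. Qed.
Fact pC_monoid : monoid_morphism pC.
Proof. by split; [exact: pC1 | exact: pCM]. Qed.
HB.instance Definition _ := GRing.isZmodMorphism.Build C ps pC pC_zmod.
HB.instance Definition _ := GRing.isMonoidMorphism.Build C ps pC pC_monoid.

Local Notation mono := (@mono R n).

Lemma pcoef_monoM b f a : (mono b * f) a = if mi_le b a then f (mi_sub a b) else 0.
Proof.
rewrite pcoefM; case: ifP => h.
  rewrite (bigD1_seq b) ?uniq_below ?mem_below//= /Defs.mono eqxx mul1r.
  by rewrite big1 ?addr0// => c /negPf ->; rewrite mul0r.
rewrite big_seq big1// => c; rewrite mem_below => hc; rewrite /Defs.mono.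
by case: eqP hc h => [-> ->|]; rewrite ?mul0r.
Qed.

Lemma pcoef_monoMD b f a : (mono b * f) (mi_add b a) = f a.
Proof. by rewrite pcoef_monoM mi_le_add mi_addKl. Qed.

Lemma monoM a b : mono a * mono b = mono (mi_add a b).
Proof.
apply: psP => c; rewrite pcoef_monoM /Defs.mono; case: ifP => h.
  congr (_ %:R); congr nat_of_bool; apply/eqP/eqP => [<-|->].
    by rewrite mi_addC mi_subK.
  by rewrite mi_addKl.
by case: eqP h => // ->; rewrite mi_le_add.
Qed.

Lemma pderivD i f g : pderiv i (f + g) = pderiv i f + pderiv i g.
Proof. by apply: psP => a; rewrite pcoefD /pderiv pcoefD mulrDr. Qed.

Lemma pderivCM i (c : C) f : pderiv i (pC c * f) = pC c * pderiv i f.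
Proof. by apply: psP => a; rewrite pcoefCM /pderiv pcoefCM mulrCA. Qed.

Lemma pderivM i f g : pderiv i (f * g) = pderiv i f * g + f * pderiv i g.
Proof.
apply: psP => a; rewrite pcoefD /pderiv !pcoefM mulr_sumr.
set e := mi_unit i.
have he : mi_le e (mi_add a e) by rewrite mi_addC mi_le_add.
(* The factor a_i + 1 of the derivative is shared between the two exponents as b_i + (a_i + 1 -
   b_i). *)
transitivity (\sum_(b <- mi_below (mi_add a e)) (b i)%:R * (f b * g (mi_sub (mi_add a e) b))
  + \sum_(b <- mi_below (mi_add a e)) f b * ((a i).+1 - b i)%:R * g (mi_sub (mi_add a e) b)).
  rewrite -big_split; apply: eq_big_seq => b; rewrite mem_below => /mi_leP/(_ i).
  rewrite !miE eqxx addn1 => h /=; rewrite natrB//; ring.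
congr (_ + _).
  rewrite (bigID (mi_le e)) /= [X in _ + X]big1 ?addr0; last first.
    by move=> b; rewrite mi_leU lt0n negbK => /eqP ->; rewrite mul0r.
  rewrite -big_filter -(perm_big _ (below_ge he)) [LHS]big_map mi_addK.
  apply: eq_big_seq => b; rewrite mem_below => /mi_leP h.
  rewrite !miE eqxx add1n mulrA [mi_add b _]mi_addC; congr (_ * g _).
  by apply/ffunP => j; rewrite !miE; have := h j; lia.
have ha : mi_le a (mi_add a e) by exact: mi_le_add.
(* The exponents below a + e_i that are not below a have b_i = a_i + 1, and their weight
   vanishes. *)
rewrite (bigID (fun b => mi_le b a)) /= [X in _ + X]big_seq_cond [X in _ + X]big1 ?addr0; last first.
  move=> b; rewrite mem_below => /andP[/mi_leP h1 h2].
  have -> : b i = (a i).+1.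
    case/forallPn: h2 => j; have := h1 j; rewrite !miE.
    by case: eqP => [-> |] => /=; lia.
  by rewrite subnn mulr0 mul0r.
rewrite -big_filter -(perm_big _ (below_le ha)).
apply: eq_big_seq => b; rewrite mem_below => /mi_leP h.
rewrite -mulrA !miE subSn ?h//; congr (_ * (_ * g _)).
by apply/ffunP => j; rewrite !miE; have := h j; lia.
Qed.

Lemma pderiv_mono i b :
  pderiv i (mono b) = pC (b i)%:R * mono (mi_sub b (mi_unit i)).
Proof.
apply: psP => a; rewrite pcoefCM /pderiv /Defs.mono.
case: (posnP (b i)) => hb.
  rewrite hb mul0r; case: eqP => [h|]; last by rewrite mulr0.
  by move: hb; rewrite -h !miE eqxx addn1.
have -> : (mi_add a (mi_unit i) == b) = (a == mi_sub b (mi_unit i)).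
  apply/eqP/eqP => [<-|->]; first by rewrite mi_addK.
  by rewrite mi_subK// mi_leU.
by case: eqP => [->|]; rewrite ?mulr0// !miE eqxx subn1 prednK.
Qed.

Fact pderiv_zmod i : zmod_morphism (@pderiv R n i).
Proof.
by move=> f g; apply: psP => a; rewrite pcoefB /pderiv pcoefB mulrBr.
Qed.
HB.instance Definition _ i := GRing.isZmodMorphism.Build ps ps (@pderiv R n i) (pderiv_zmod i).

End Ring.

(** * Norms and convergence *)

Section ComplexModulus.
Variable R : realType.
Local Notation C := (R[i]).
Implicit Types z w : C.

(** The norm on [C] takes its values in [C]; a modulus in [R] gives access to suprema and real
    arithmetic. *)
Definition cmod z : R := complex.Re `|z|.

Lemma cmodE z : `|z| = (cmod z)%:C%C.
Proof. by rewrite /cmod normc_def. Qed.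
Lemma cmod_ge0 z : 0 <= cmod z.
Proof. by rewrite -lecR -cmodE normr_ge0. Qed.
Lemma cmod0 : cmod 0 = 0. Proof. by rewrite /cmod normr0. Qed.
Lemma cmod1 : cmod 1 = 1. Proof. by rewrite /cmod normr1. Qed.
Lemma cmodM z w : cmod (z * w) = cmod z * cmod w.
Proof. by apply: (@complexI R); rewrite rmorphM -!cmodE normrM. Qed.
Lemma cmodX z k : cmod (z ^+ k) = cmod z ^+ k.
Proof. by elim: k => [|k IH]; rewrite ?expr0 ?cmod1// !exprS cmodM IH. Qed.
Lemma cmodN z : cmod (- z) = cmod z. Proof. by rewrite /cmod normrN. Qed.
Lemma cmodB z w : cmod (z - w) = cmod (w - z). Proof. by rewrite /cmod distrC. Qed.
Lemma cmodD z w : cmod (z + w) <= cmod z + cmod w.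
Proof. by rewrite -lecR rmorphD/= -!cmodE ler_normD. Qed.
Lemma cmod_eq0 z : cmod z = 0 -> z = 0.
Proof. by move=> h; apply/eqP; rewrite -normr_eq0 cmodE h. Qed.
Lemma cmodR (x : R) : cmod x%:C%C = `|x|.
Proof. by rewrite /cmod normc_def/= expr0n/= addr0 sqrtr_sqr. Qed.
Lemma cmod_nat k : cmod k%:R = k%:R.
Proof. by rewrite -(rmorph_nat (real_complex R)) cmodR ger0_norm. Qed.
Lemma cmodV z : cmod z^-1 = (cmod z)^-1.
Proof. by apply: (@complexI R); rewrite fmorphV/= -!cmodE normfV. Qed.
Lemma cmod_sum (I : Type) (s : seq I) (P : pred I) (F : I -> C) :
  cmod (\sum_(i <- s | P i) F i) <= \sum_(i <- s | P i) cmod (F i).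
Proof.
elim/big_rec2: _ => [|i x y _ h]; first by rewrite cmod0.
by apply: le_trans (cmodD _ _) _; rewrite lerD2l.
Qed.
End ComplexModulus.

Lemma sum_subset_le (R : realType) (T : eqType) (s t : seq T) (F : T -> R) :
  uniq s -> uniq t -> {subset s <= t} -> (forall x, 0 <= F x) ->
  \sum_(x <- s) F x <= \sum_(x <- t) F x.
Proof.
move=> us ut st F0.
have h : perm_eq s [seq x <- t | x \in s].
  apply: uniq_perm; rewrite ?filter_uniq// => x.
  by rewrite mem_filter; case: (boolP (x \in s)) => //= /st ->.
rewrite (perm_big _ h) big_filter (bigID (mem s) xpredT)/= lerDl.
by apply: sumr_ge0.
Qed.

Section Norm.
Variables (R : realType) (n : nat).
Local Notation C := (R[i]).
Local Notation ps := (ps R n).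
Implicit Types (f g q : ps) (a b : mi n) (r M N : R).

(* The weighted l1-norm is submultiplicative, unlike the weighted supremum in [convergent]. *)
Definition nrm r q M :=
  forall s : seq (mi n), uniq s -> \sum_(a <- s) cmod (q a) * r ^+ mdegree a <= M.

Lemma nrm_ge0 r q M : nrm r q M -> 0 <= M.
Proof. by move=> /(_ [::] isT); rewrite big_nil. Qed.
Lemma nrm_coef r q M a : nrm r q M -> cmod (q a) * r ^+ mdegree a <= M.
Proof. by move=> /(_ [:: a] isT); rewrite big_seq1. Qed.
Lemma nrm_le r q M N : M <= N -> nrm r q M -> nrm r q N.
Proof. by move=> h k s us; apply: le_trans (k s us) h. Qed.
Lemma nrm_mono r r' q M : 0 <= r -> r <= r' -> nrm r' q M -> nrm r q M.
Proof.
move=> r0 h k s us; apply: le_trans (k s us); apply: ler_sum => a _.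
by rewrite ler_wpM2l ?cmod_ge0// lerXn2r// nnegrE (le_trans r0).
Qed.
Lemma nrmD r f g M N : 0 <= r -> nrm r f M -> nrm r g N -> nrm r (f + g) (M + N).
Proof.
move=> r0 h k s us; apply: le_trans (lerD (h s us) (k s us)).
rewrite -big_split; apply: ler_sum => a _ /=.
by rewrite -mulrDl ler_wpM2r ?exprn_ge0// cmodD.
Qed.
Lemma nrm0 r : nrm r 0 0.
Proof. by move=> s us; rewrite big1// => a _; rewrite cmod0 mul0r. Qed.
Lemma nrm_sum (I : Type) (s : seq I) (P : pred I) (F : I -> ps) (M : I -> R) r :
  0 <= r -> (forall i, P i -> nrm r (F i) (M i)) ->
  nrm r (\sum_(i <- s | P i) F i) (\sum_(i <- s | P i) M i).
Proof.
move=> r0 h; elim/big_rec2: _ => [|i x y Pi k]; first exact: nrm0.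
by apply: nrmD => //; apply: h.
Qed.
Lemma nrmZ r (c : C) q M : nrm r q M -> nrm r (pC c * q) (cmod c * M).
Proof.
move=> h s us; apply: le_trans (ler_wpM2l (cmod_ge0 c) (h s us)).
rewrite mulr_sumr; apply: ler_sum => a _; by rewrite pcoefCM cmodM mulrA.
Qed.
Lemma nrmN r q M : nrm r q M -> nrm r (- q) M.
Proof.
move=> h s us; apply: le_trans (h s us); apply: ler_sum => a _.
by rewrite pcoefN cmodN.
Qed.
Lemma nrm_mono1 r b : 0 <= r -> nrm r (mono R b) (r ^+ mdegree b).
Proof.
move=> r0 s us; case: (boolP (b \in s)) => hb.
  rewrite (bigD1_seq b)//= big1 ?addr0.
    by rewrite /mono eqxx cmod1 mul1r.
  by move=> a /negPf h; rewrite /mono h cmod0 mul0r.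
rewrite big_seq big1 ?exprn_ge0// => a ha; rewrite /mono.
by case: eqP ha hb => [-> ->//|]; rewrite cmod0 mul0r.
Qed.
Lemma nrm1 r : 0 <= r -> nrm r 1 1.
Proof. by move=> r0; have := nrm_mono1 (@mi_zero n) r0; rewrite mdeg0 expr0. Qed.

Lemma nrmM r f g M N : 0 <= r -> nrm r f M -> nrm r g N -> nrm r (f * g) (M * N).
Proof.
move=> r0 hf hg s us.
set F := fun a => cmod (f a) * r ^+ mdegree a.
set G := fun a => cmod (g a) * r ^+ mdegree a.
have F0 a : 0 <= F a by rewrite mulr_ge0 ?cmod_ge0 ?exprn_ge0.
(* [U] contains every exponent met in the convolutions, so the double sum can be exchanged; for
   fixed b the exponents a - b are distinct and form an admissible finite family for [g]. *)
pose U := undup (flatten [seq mi_below a | a <- s]).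
have hU a : a \in s -> perm_eq (mi_below a) [seq b <- U | mi_le b a].
  move=> ha; apply: uniq_perm => [||b]; first exact: uniq_below.
    by rewrite filter_uniq ?undup_uniq.
  rewrite mem_filter mem_undup mem_below; case: (boolP (mi_le b a)) => //= h.
  by apply/esym/flattenP; exists (mi_below a); rewrite ?map_f ?mem_below.
apply: (@le_trans _ _ (\sum_(a <- s) \sum_(b <- U | mi_le b a) F b * G (mi_sub a b))).
  rewrite big_seq [X in _ <= X]big_seq; apply: ler_sum => a ha.
  rewrite -big_filter -(perm_big _ (hU a ha)) pcoefM.
  apply: le_trans (ler_wpM2r (exprn_ge0 _ r0) (cmod_sum _ _ _)) _.
  rewrite mulr_suml [leLHS]big_seq [leRHS]big_seq; apply: ler_sum => b.
  rewrite mem_below => hb; rewrite /F /G cmodM.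
  have -> : mdegree a = (mdegree (mi_sub a b) + mdegree b)%N by rewrite -mdegD mi_subK.
  rewrite exprD.
  by rewrite le_eqVlt; apply/orP; left; apply/eqP; ring.
rewrite (exchange_big_dep xpredT)//=.
have uU : uniq U by exact: undup_uniq.
apply: le_trans (ler_wpM2r (nrm_ge0 hg) (hf U uU)).
rewrite mulr_suml; apply: ler_sum => b _; rewrite -mulr_sumr ler_wpM2l//.
rewrite -big_filter -(big_map (fun a => mi_sub a b) xpredT G); apply: hg.
rewrite map_inj_in_uniq ?filter_uniq// => a c; rewrite !mem_filter.
move=> /andP[ha _] /andP[hc _] h; by rewrite -(mi_subK ha) h mi_subK.
Qed.

Lemma nrmX r f M k : 0 <= r -> nrm r f M -> nrm r (f ^+ k) (M ^+ k).
Proof.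
move=> r0 h; elim: k => [|k IH]; first by rewrite !expr0; exact: nrm1.
by rewrite !exprS; apply: nrmM.
Qed.

Lemma expr_diff_ge (x y : R) d : 0 <= x -> x <= y ->
  d.+1%:R * x ^+ d * (y - x) <= y ^+ d.+1.
Proof.
move=> x0 xy; have y0 := le_trans x0 xy.
apply: (@le_trans _ _ (y ^+ d.+1 - x ^+ d.+1)); last first.
  by rewrite lerBlDr lerDl exprn_ge0.
rewrite subrXX mulrC ler_wpM2l ?subr_ge0//.
apply: (@le_trans _ _ (\sum_(i < d.+1) x ^+ d)).
  by rewrite sumr_const card_ord mulr_natl.
apply: ler_sum => i _ /=.
rewrite -[X in x ^+ X <= _](@subnK i d) ?exprD; last by rewrite -ltnS.
by rewrite ler_wpM2r ?exprn_ge0// lerXn2r// nnegrE.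
Qed.

(** Cauchy's estimate: raising exponents by e_i is injective, and the factor a_i + 1 is absorbed by
    the mean value inequality [expr_diff_ge]. *)
Lemma nrm_pderiv r r' q M i : 0 <= r -> r < r' -> nrm r' q M ->
  nrm r (pderiv i q) (M / (r' - r)).
Proof.
move=> r0 rr h s us; rewrite ler_pdivlMr ?subr_gt0//.
have us' : uniq (map (fun a => mi_add a (mi_unit i)) s).
  by rewrite map_inj_uniq// => a b; rewrite ![mi_add _ (mi_unit i)]mi_addC => /mi_addI.
apply: le_trans (h _ us'); rewrite [X in _ <= X]big_map mulr_suml.
apply: ler_sum => a _; rewrite /pderiv cmodM cmod_nat mdegD mdegU addn1.
rewrite [_ * cmod _]mulrC -!mulrA ler_wpM2l ?cmod_ge0//.
apply: le_trans (expr_diff_ge (mdegree a) r0 (ltW rr)).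
rewrite mulrA ler_wpM2r ?subr_ge0 ?(ltW rr)// ler_wpM2r ?exprn_ge0//.
by rewrite ler_nat ltnS coord_le_deg.
Qed.

(** Without a constant term, every monomial has positive degree and gains at least one factor
    [l]. *)
Lemma nrm_shrink l r q M : q mi_zero = 0 -> 0 <= r -> 0 <= l -> l <= 1 ->
  nrm r q M -> nrm (l * r) q (l * M).
Proof.
move=> q0 r0 l0 l1 h s us; apply: le_trans (ler_wpM2l l0 (h s us)).
rewrite mulr_sumr; apply: ler_sum => a _.
case: (posnP (mdegree a)) => [/mdeg_eq0 ->|ha]; first by rewrite q0 cmod0 !mul0r mulr0.
rewrite mulrCA ler_wpM2l ?cmod_ge0// exprMn ler_wpM2r ?exprn_ge0//.
by rewrite -(prednK ha) exprS ler_piMr// exprn_ile1.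
Qed.

Lemma sum_geom_half k : \sum_(i < k) (2^-1 : R) ^+ i <= 2.
Proof.
have -> : \sum_(i < k) (2^-1 : R) ^+ i = 2 - 2 * 2^-1 ^+ k.
  elim: k => [|k IH]; first by rewrite big_ord0 expr0; ring.
  by rewrite big_ord_recr/= IH exprS; field.
by rewrite lerBlDr lerDl mulr_ge0// exprn_ge0// invr_ge0.
Qed.

(** The sum is dominated by a product of [n] geometric series, each at most 2. It is the price for
    passing from a weighted supremum to the l1-norm at half the radius. *)
Lemma sum_half_deg (s : seq (mi n)) : uniq s ->
  \sum_(a <- s) (2^-1 : R) ^+ mdegree a <= 2 ^+ n.
Proof.
move=> us; pose K := (\max_(a <- s) mdegree a).+1.
pose emb (b : {ffun 'I_n -> 'I_K}) : mi n := [ffun i => nat_of_ord (b i)].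
have injb : injective emb.
  move=> b c /ffunP h; apply/ffunP => i; apply/val_inj.
  by have := h i; rewrite !ffunE.
pose t := [seq emb x | x <- enum {ffun 'I_n -> 'I_K}].
have ut : uniq t by rewrite map_inj_uniq// enum_uniq.
have st : {subset s <= t}.
  move=> a ha; have hd i : (a i < K)%N.
    rewrite ltnS (leq_trans (coord_le_deg a i))//.
    by rewrite (big_rem a)//= leq_maxl.
  apply/mapP; exists [ffun i => Ordinal (hd i)]; first by rewrite mem_enum.
  by apply/ffunP => i; rewrite !ffunE.
apply: le_trans (sum_subset_le us ut st _) _ => [a|]; first by rewrite exprn_ge0// invr_ge0.
rewrite /t big_map big_enum/=.
have -> : \sum_(x : {ffun 'I_n -> 'I_K}) (2^-1 : R) ^+ mdegree (emb x) =
    \prod_(i < n) \sum_(j < K) 2^-1 ^+ j.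
  rewrite bigA_distr_bigA/=; apply: eq_bigr => b _.
  rewrite /mdegree -prodrXr; apply: eq_bigr => i _; by rewrite ffunE.
rewrite -[X in _ ^+ X]card_ord -prodr_const; apply: ler_prod => i _.
rewrite sum_geom_half andbT; apply: sumr_ge0 => j _.
by rewrite exprn_ge0// invr_ge0.
Qed.

Lemma sup_nrm r q M : 0 <= r -> (forall a, cmod (q a) * r ^+ mdegree a <= M) ->
  nrm (r / 2) q (M * 2 ^+ n).
Proof.
move=> r0 h s us.
have M0 : 0 <= M by apply: le_trans (h mi_zero); rewrite mulr_ge0 ?cmod_ge0 ?exprn_ge0.
apply: le_trans (ler_wpM2l M0 (sum_half_deg us)).
rewrite mulr_sumr; apply: ler_sum => a _; rewrite exprMn mulrA.
by rewrite ler_wpM2r// exprn_ge0// invr_ge0.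
Qed.

Lemma convergent_sup q : convergent q <->
  exists r M, 0 < r /\ forall a, cmod (q a) * r ^+ mdegree a <= M.
Proof.
split=> [[r [M [r0 h]]]|[r [M [r0 h]]]].
  (* A nonnegative element in the order of [C] is real, so the radius and the bound in [convergent]
     come from [R]. *)
  have [r' r'E] : exists r' : R, r = r'%:C%C.
    by exists (complex.Re r); case: r r0 {h} => x y; rewrite ltcE/= => /andP[/eqP -> _].
  have [M' M'E] : exists M' : R, M = M'%:C%C.
    have M0 : 0 <= M by apply: le_trans (h mi_zero); rewrite mulr_ge0 ?normr_ge0 ?exprn_ge0// ltW.
    by exists (complex.Re M); case: M M0 {h} => x y; rewrite lecE/= => /andP[/eqP -> _].
  exists r', M'; split; first by move: r0; rewrite r'E ltcR.
  by move=> a; have := h a; rewrite r'E M'E cmodE -rmorphXn -rmorphM lecR.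
exists r%:C%C, M%:C%C; split; first by rewrite ltcR.
by move=> a; rewrite cmodE -rmorphXn -rmorphM lecR.
Qed.

Lemma convergentP q : convergent q <-> exists r M, 0 < r /\ nrm r q M.
Proof.
rewrite convergent_sup; split=> [[r [M [r0 h]]]|[r [M [r0 h]]]].
  by exists (r / 2), (M * 2 ^+ n); split; [rewrite divr_gt0 | apply: sup_nrm => //; apply: ltW].
by exists r, M; split => // a; apply: nrm_coef.
Qed.

Definition conv : {pred ps} := fun q => `[< convergent q >].

Lemma convP q : reflect (exists r M, 0 < r /\ nrm r q M) (q \in conv).
Proof. by apply: (iffP (asboolP _)) => /convergentP. Qed.

Fact conv_subring : subring_closed conv.
Proof.
split.
- by apply/convP; exists 1, 1; split=> //; apply: nrm1.
- move=> f g /convP[r [M [r0 h]]] /convP[r' [M' [r'0 h']]]; apply/convP.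
  have m0 : 0 < Num.min r r' by rewrite lt_min r0.
  exists (Num.min r r'), (M + M'); split=> //; apply: nrmD; rewrite ?ltW//.
    by apply: nrm_mono h; rewrite ?ge_min ?lexx// ltW.
  by apply: nrmN; apply: nrm_mono h'; rewrite ?ge_min ?lexx ?orbT// ltW.
- move=> f g /convP[r [M [r0 h]]] /convP[r' [M' [r'0 h']]]; apply/convP.
  have m0 : 0 < Num.min r r' by rewrite lt_min r0.
  exists (Num.min r r'), (M * M'); split=> //; apply: nrmM; rewrite ?ltW//.
    by apply: nrm_mono h; rewrite ?ge_min ?lexx// ltW.
  by apply: nrm_mono h'; rewrite ?ge_min ?lexx ?orbT// ltW.
Qed.
HB.instance Definition _ := GRing.isSubringClosed.Build ps conv conv_subring.

Lemma conv_mono b : mono R b \in conv.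
Proof. by apply/convP; exists 1, (1 ^+ mdegree b); split=> //; apply: nrm_mono1. Qed.
Lemma conv_pC (c : C) : (pC c : ps) \in conv.
Proof.
apply/convP; exists 1, (cmod c * 1); split=> //; rewrite -[pC c]mulr1.
by apply: nrmZ; apply: nrm1.
Qed.
Lemma conv_pderiv i q : q \in conv -> pderiv i q \in conv.
Proof.
move=> /convP[r [M [r0 h]]]; apply/convP; exists (r / 2), (M / (r - r / 2)).
split; first by rewrite divr_gt0.
by apply: nrm_pderiv h; lra.
Qed.

Definition ordge k q := forall a, (mdegree a < k)%N -> q a = 0.

Lemma ordgeM k l f g : ordge k f -> ordge l g -> ordge (k + l) (f * g).
Proof.
move=> hf hg a ha; rewrite pcoefM big_seq big1// => b; rewrite mem_below => hb.
have : (mdegree b < k)%N \/ (mdegree (mi_sub a b) < l)%N.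
  by move: ha; rewrite -{1}(mi_subK hb) mdegD; lia.
by case=> [/hf ->|/hg ->]; rewrite ?mul0r ?mulr0.
Qed.
Lemma ordgeX k f : f mi_zero = 0 -> ordge k (f ^+ k).
Proof.
move=> f0; elim: k => [a|k IH]; first by rewrite ltn0.
rewrite exprS -add1n; apply: ordgeM => // a; rewrite ltnS leqn0 => /eqP/mdeg_eq0 ->.
exact: f0.
Qed.

Lemma pcoefM_local f g g' a : (forall b, mi_le b a -> g b = g' b) ->
  (f * g) a = (f * g') a.
Proof.
move=> h; rewrite !pcoefM; apply: eq_big_seq => b; rewrite mem_below => hb.
by rewrite h// mi_le_sub.
Qed.

Lemma conv_geom u : u \in conv -> u mi_zero = 0 ->
  exists2 v, v \in conv & (1 - u) * v = 1.
Proof.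
move=> /convP[r [M [r0 h]]] u0.
(* u^k has order at least k, so each coefficient of the geometric series is a finite sum. *)
pose v : ps := fun a => \sum_(k < (mdegree a).+1) (u ^+ k) a.
have vE K a : (mdegree a < K)%N -> v a = (\sum_(k < K) u ^+ k) a.
  move=> hK; rewrite pcoef_sum /v (big_ord_widen _ (fun k => (u ^+ k) a) hK) big_mkcond/=.
  by apply: eq_bigr => k _; case: ltnP => // hk; rewrite ordgeX.
exists v; last first.
  apply: psP => a; rewrite (@pcoefM_local _ _ (\sum_(k < (mdegree a).+1) u ^+ k)); last first.
    by move=> b /mi_le_deg hb; apply: vE.
  rewrite -opprB mulNr -subrX1 opprB pcoefB.
  by rewrite (@ordgeX (mdegree a).+1)// subr0.
have M0 := nrm_ge0 h.
(* Shrinking the radius by [l] brings the norm of [u] down to 1/2, so its powers are summable. *)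
pose l : R := (2 * M + 2)^-1.
have l0 : 0 < l by rewrite invr_gt0; lra.
have l1 : l <= 1 by rewrite invf_le1; lra.
have lM : l * M <= 2^-1.
  by rewrite mulrC ler_pdivrMr; lra.
have hl := nrm_le lM (nrm_shrink u0 (ltW r0) (ltW l0) l1 h).
have lr0 : 0 <= l * r by rewrite mulr_ge0// ltW.
apply/asboolP/convergent_sup; exists (l * r), 2; split; first by rewrite mulr_gt0.
move=> a; apply: le_trans (ler_wpM2r (exprn_ge0 _ lr0) (cmod_sum _ _ _)) _.
rewrite mulr_suml; apply: le_trans (sum_geom_half (mdegree a).+1).
by apply: ler_sum => k _; apply: nrm_coef; apply: nrmX.
Qed.

Lemma conv_unit q : q \in conv -> q mi_zero != 0 ->
  exists2 v, v \in conv & q * v = 1.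
Proof.
move=> hq q0; set c := q mi_zero in q0 *.
have [||v hv hE] := @conv_geom (1 - pC c^-1 * q).
- by rewrite rpredB ?rpred1// rpredM ?conv_pC.
- by rewrite pcoefB pcoef1 eqxx pcoefCM mulVf ?subrr.
exists (pC c^-1 * v); first by rewrite rpredM ?conv_pC.
by rewrite mulrCA mulrA -hE; congr (_ * _); ring.
Qed.

End Norm.
Arguments conv {R n}.

(** * Geometrically convergent sums *)

Section GeometricSums.
Variable R : realType.
Local Notation C := (R[i]).
Implicit Types (u v : nat -> C) (l : C) (M x : R).

Lemma le0_of_geometric x M : (forall N, x <= M * 2^-1 ^+ N) -> x <= 0.
Proof.
move=> h; rewrite leNgt; apply/negP => x0.
have M0 : 0 < M by have := h 0%N; rewrite expr0 mulr1; lra.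
have [N hN] : exists N : nat, M / x < N%:R.
  by exists (Num.trunc (M / x)).+1; exact: truncnS_gt.
have := h N; apply/negP; rewrite -ltNge exprVn ltr_pdivrMr ?exprn_gt0//.
rewrite -ltr_pdivrMl// mulrC; apply: (lt_le_trans hN).
by rewrite -natrX ler_nat ltnW// ltn_expl.
Qed.

(** Convergence at a fixed geometric rate keeps limits elementary. The rate 1/2 is slower than the
    bound 4^-k put on the terms elsewhere: the slack absorbs a factor N in [gsum_double]. *)
Definition gsum u l := exists M, forall N, cmod (\sum_(k < N) u k - l) <= M * 2^-1 ^+ N.

Lemma gsum_uniq u l l' : gsum u l -> gsum u l' -> l = l'.
Proof.
move=> [M h] [M' h']; apply/eqP; rewrite -subr_eq0; apply/eqP/cmod_eq0/eqP.
rewrite eq_le cmod_ge0 andbT; apply: (@le0_of_geometric _ (M + M')) => N.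
have -> : l - l' = (\sum_(k < N) u k - l') - (\sum_(k < N) u k - l) by ring.
apply: le_trans (cmodD _ _) _; rewrite cmodN mulrDl [leRHS]addrC lerD//.
Qed.

Lemma eq_gsum u v l : u =1 v -> gsum u l -> gsum v l.
Proof.
move=> e [M h]; exists M => N.
by have := h N; rewrite (eq_bigr (fun k : 'I_N => v k)).
Qed.

Lemma gsumD u v l l' : gsum u l -> gsum v l' -> gsum (fun k => u k + v k) (l + l').
Proof.
move=> [M h] [M' h']; exists (M + M') => N; rewrite big_split/=.
have -> (a b : C) : a + b - (l + l') = (a - l) + (b - l') by ring.
by apply: le_trans (cmodD _ _) _; rewrite mulrDl; apply: lerD; [exact: h | exact: h'].
Qed.

Lemma gsumZ (c : C) u l : gsum u l -> gsum (fun k => c * u k) (c * l).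
Proof.
move=> [M h]; exists (cmod c * M) => N.
by rewrite -mulr_sumr -mulrBr cmodM -mulrA ler_wpM2l ?cmod_ge0.
Qed.

Lemma gsum_finite u K : (forall k, (K <= k)%N -> u k = 0) -> gsum u (\sum_(k < K) u k).
Proof.
move=> h; exists (2 ^+ K * \sum_(k < K) cmod (u k)) => N.
have S0 : 0 <= \sum_(k < K) cmod (u k) by apply: sumr_ge0 => k _; exact: cmod_ge0.
case: (leqP K N) => hN.
  have -> : \sum_(k < N) u k - \sum_(k < K) u k = 0.
    rewrite -!(big_mkord xpredT) (big_cat_nat (leq0n K) hN)//=.
    rewrite [X in _ + X - _]big_nat_cond [X in _ + X - _]big1 ?addr0 ?subrr//.
    by move=> k /andP[/andP[hk _] _]; rewrite h.
  by rewrite cmod0 !mulr_ge0// exprn_ge0// invr_ge0.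
rewrite cmodB -!(big_mkord xpredT) (big_cat_nat (leq0n N) (ltnW hN))//= [X in X - _]addrC addrK.
apply: (@le_trans _ _ (\sum_(0 <= k < K) cmod (u k))).
  apply: le_trans (cmod_sum _ _ _) _; rewrite (big_cat_nat (leq0n N) (ltnW hN))//= lerDr.
  by apply: sumr_ge0 => k _; exact: cmod_ge0.
rewrite !big_mkord -mulrAC ler_peMl// exprVn ler_pdivlMr ?exprn_gt0// mul1r.
by rewrite ler_eXn2l ?(ltnW hN)//; lra.
Qed.

Lemma gsum0 : gsum (fun=> 0) 0.
Proof. by have := @gsum_finite (fun=> 0) 0 (fun k _ => erefl); rewrite big_ord0. Qed.

Lemma gsum_sum (I : Type) (s : seq I) (F : I -> nat -> C) (l : I -> C) :
  (forall i, gsum (F i) (l i)) ->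
  gsum (fun k => \sum_(i <- s) F i k) (\sum_(i <- s) l i).
Proof.
move=> h; elim: s => [|i s IH].
  by rewrite big_nil; apply: eq_gsum gsum0 => k; rewrite big_nil.
rewrite big_cons; apply: eq_gsum (gsumD (h i) IH) => k; by rewrite big_cons.
Qed.

Lemma sum_geom_quarter m N : (m <= N)%N ->
  \sum_(m <= k < N) (4^-1 : R) ^+ k <= 2 * 4^-1 ^+ m.
Proof.
move=> hmN; have -> : \sum_(m <= k < N) (4^-1 : R) ^+ k = 4/3 * (4^-1 ^+ m - 4^-1 ^+ N).
  rewrite -(subnKC hmN); elim: (N - m)%N => [|k IH]; first by rewrite addn0 big_geq// subrr mulr0.
  by rewrite addnS big_nat_recr ?leq_addr//= IH exprS; field.
have h k : 0 <= (4^-1 : R) ^+ k by rewrite exprn_ge0// invr_ge0.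
by have := h m; have := h N; lra.
Qed.

Lemma partial_sums_le u M m N : (forall k, cmod (u k) <= M * 4^-1 ^+ k) -> (m <= N)%N ->
  cmod (\sum_(k < N) u k - \sum_(k < m) u k) <= 2 * M * 4^-1 ^+ m.
Proof.
move=> h hmN; rewrite -!(big_mkord xpredT) (big_cat_nat (leq0n m) hmN)//= [X in X - _]addrC addrK.
have M0 : 0 <= M by have := h 0%N; rewrite expr0 mulr1; apply: le_trans; apply: cmod_ge0.
apply: le_trans (cmod_sum _ _ _) _.
apply: (@le_trans _ _ (\sum_(m <= k < N) M * 4^-1 ^+ k)); first by apply: ler_sum.
rewrite -mulr_sumr [2 * M]mulrC -mulrA ler_wpM2l//; exact: sum_geom_quarter.
Qed.

(** Completeness as nested intervals: no left end exceeds a right end, and [l] is the supremum of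
    the left ends. *)
Lemma real_nested (x e : nat -> R) :
  (forall N K, x N - e N <= x K + e K) -> exists l : R, forall N, `|x N - l| <= e N.
Proof.
move=> h; pose A := [set y | exists N, y = x N - e N]%classic.
have supA : has_sup A.
  split; first by exists (x 0%N - e 0%N), 0%N.
  by exists (x 0%N + e 0%N) => _ [N ->].
exists (sup A) => N; rewrite ler_norml; apply/andP; split.
  suff : sup A <= x N + e N by lra.
  by apply: ge_sup => [|_ [K ->]//]; case: supA.
suff : x N - e N <= sup A by lra.
by apply: ub_le_sup; [case: supA | exists N].
Qed.

Lemma normRe_le_cmod (z : C) : `|complex.Re z| <= cmod z.
Proof. by rewrite -lecR -cmodE; exact: normc_ge_Re. Qed.
Lemma normIm_le_cmod (z : C) : `|complex.Im z| <= cmod z.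
Proof.
rewrite /cmod normc_def/= -sqrtr_sqr ler_sqrt ?addr_ge0 ?sqr_ge0//.
by rewrite lerDr sqr_ge0.
Qed.
Lemma cmod_le_ReIm (z : C) : cmod z <= `|complex.Re z| + `|complex.Im z|.
Proof.
have -> : z = (complex.Re z)%:C%C + (0 +i* 1)%C * (complex.Im z)%:C%C.
  by case: z => a b; apply/eqP; rewrite eq_complex/=; apply/andP; split; apply/eqP; ring.
apply: le_trans (cmodD _ _) _; rewrite cmodM !cmodR.
have -> : cmod (0 +i* 1)%C = 1 :> R.
  by rewrite /cmod normc_def/= expr0n/= expr1n add0r sqrtr1.
by rewrite mul1r; case: z => a b /=; rewrite !(mulr0, mul0r, mul1r, mulr1, addr0, subr0, subrr, add0r).
Qed.

Lemma gsum_ex u M : (forall k, cmod (u k) <= M * 4^-1 ^+ k) -> exists l, gsum u l.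
Proof.
move=> h; set S := fun N => \sum_(k < N) u k.
have e0 N : 0 <= 2 * M * 4^-1 ^+ N.
  have M0 : 0 <= M by have := h 0%N; rewrite expr0 mulr1; apply: le_trans; apply: cmod_ge0.
  by rewrite !mulr_ge0// exprn_ge0// invr_ge0.
have hS N K : cmod (S N - S K) <= 2 * M * 4^-1 ^+ N + 2 * M * 4^-1 ^+ K.
  case: (leqP K N) => hNK.
    by apply: le_trans (partial_sums_le h hNK) _; rewrite lerDr.
  by rewrite cmodB; apply: le_trans (partial_sums_le h (ltnW hNK)) _; rewrite lerDl.
have [a ha] : exists a, forall N, `|complex.Re (S N) - a| <= 2 * M * 4^-1 ^+ N.
  apply: real_nested => N K; have := le_trans (normRe_le_cmod _) (hS N K).
  by rewrite raddfB ler_norml => /andP[_]; lra.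
have [b hb] : exists b, forall N, `|complex.Im (S N) - b| <= 2 * M * 4^-1 ^+ N.
  apply: real_nested => N K; have := le_trans (normIm_le_cmod _) (hS N K).
  by rewrite raddfB ler_norml => /andP[_]; lra.
exists (a +i* b)%C, (4 * M) => N; apply: le_trans (cmod_le_ReIm _) _.
rewrite !raddfB/=.
apply: (@le_trans _ _ (4 * M * 4^-1 ^+ N)).
  by have := ha N; have := hb N; rewrite /S; lra.
apply: ler_wpM2l; first by have := e0 0%N; rewrite expr0; lra.
by rewrite lerXn2r// ?nnegrE; lra.
Qed.

(** The unknown constant in [gsum] disappears by comparing with a later partial sum K' and letting K
    grow; only the bound on the terms between N and K' remains. *)
Lemma gsum_tail u l M N : gsum u l -> (forall k, cmod (u k) <= M * 4^-1 ^+ k) ->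
  cmod (\sum_(k < N) u k - l) <= 2 * M * 4^-1 ^+ N.
Proof.
move=> [M' h'] h; rewrite -subr_le0; apply: (@le0_of_geometric _ `|M'|) => K.
pose K' := maxn K N; rewrite lerBlDr.
have -> : \sum_(k < N) u k - l =
  (\sum_(k < K') u k - l) - (\sum_(k < K') u k - \sum_(k < N) u k) by ring.
apply: le_trans (cmodD _ _) _; rewrite cmodN lerD//; last first.
  by apply: partial_sums_le => //; rewrite leq_maxr.
apply: le_trans (h' K') _.
have p2 k : 0 <= (2^-1 : R) ^+ k by rewrite exprn_ge0// invr_ge0.
apply: (@le_trans _ _ (`|M'| * 2^-1 ^+ K')); first by rewrite ler_wpM2r// ler_norm.
rewrite ler_wpM2l//; apply: ler_wiXn2l; rewrite ?leq_maxl//; lra.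
Qed.

Lemma gsum_norm u l M : gsum u l -> (forall k, cmod (u k) <= M * 4^-1 ^+ k) ->
  cmod l <= 2 * M.
Proof.
by move=> h1 h2; have := gsum_tail 0 h1 h2; rewrite big_ord0 sub0r cmodN expr0 mulr1.
Qed.

Lemma sum_triangle (V : nmodType) (w : nat -> nat -> V) N :
  \sum_(m < N) \sum_(i < m.+1) w i (m - i)%N = \sum_(j < N) \sum_(k < N - j) w j k.
Proof.
elim: N => [|N IH]; first by rewrite !big_ord0.
rewrite big_ord_recr/= IH [X in _ + X]big_ord_recr/= [RHS]big_ord_recr/= addrA; congr (_ + _).
  rewrite -big_split/=; apply: eq_bigr => j _.
  by rewrite subSn ?big_ord_recr//= ltnW.
by rewrite subSnn big_ord_recl big_ord0 addr0 subnn.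
Qed.

(** The antidiagonals up to N fill a triangle whose row j is cut at N - j, with tail at most 2 M
    4^-N. The N rows lose N 4^-N in total, which is at most 2^-N. *)
Lemma gsum_double (w : nat -> nat -> C) (s : nat -> C) l M :
  (forall j k, cmod (w j k) <= M * 4^-1 ^+ (j + k)) ->
  (forall j, gsum (w j) (s j)) -> gsum s l ->
  gsum (fun m => \sum_(i < m.+1) w i (m - i)%N) l.
Proof.
move=> hw hs [M' hl]; exists (2 * M + M') => N.
rewrite sum_triangle.
have -> : \sum_(j < N) \sum_(k < N - j) w j k - l =
  \sum_(j < N) (\sum_(k < N - j) w j k - s j) + (\sum_(j < N) s j - l).
  by rewrite big_split/= sumrN; ring.
apply: le_trans (cmodD _ _) _; rewrite mulrDl lerD//.
have M0 : 0 <= M by have := hw 0%N 0%N; rewrite expr0 mulr1; apply: le_trans; apply: cmod_ge0.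
apply: le_trans (cmod_sum _ _ _) _.
apply: (@le_trans _ _ (\sum_(j < N) 2 * M * 4^-1 ^+ N)).
  apply: ler_sum => j _.
  have hj k : cmod (w j k) <= M * 4^-1 ^+ j * 4^-1 ^+ k by rewrite -mulrA -exprD.
  apply: le_trans (gsum_tail (N - j) (hs j) hj) _.
  by rewrite -!mulrA -exprD subnKC// ltnW.
rewrite sumr_const card_ord -mulrnAr ler_wpM2l ?mulr_ge0//.
have -> : (4^-1 : R) = 2^-1 * 2^-1 by field.
rewrite exprMn -mulr_natl mulrA ler_piMl ?exprn_ge0 ?invr_ge0//.
rewrite exprVn ler_pdivrMr ?exprn_gt0// mul1r -natrX ler_nat.
by apply: ltnW; exact: ltn_expl.
Qed.

End GeometricSums.

(** * Flows of time-dependent vector fields *)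

Section StrongRecursion.
Variables (T : Type) (x0 : T) (F : nat -> (nat -> T) -> T).

(** Course-of-values recursion: [srec_table k] holds all terms up to index [k], since each
    coefficient of the flow depends on all earlier ones. *)
Fixpoint srec_table k : nat -> T :=
  if k is k'.+1 then
    fun j => if j == k'.+1 then F k' (srec_table k') else srec_table k' j
  else fun=> x0.

Definition srec k := srec_table k k.

Lemma srec_tableE k j : (j <= k)%N -> srec_table k j = srec j.
Proof.
elim: k => [|k IH]; first by rewrite leqn0 => /eqP ->.
rewrite leq_eqVlt => /orP[/eqP ->//|hj] /=.
by rewrite ltn_eqF// IH.
Qed.

Hypothesis F_local :
  forall k u v, (forall j, (j <= k)%N -> u j = v j) -> F k u = F k v.

Lemma srecS k : srec k.+1 = F k srec.
Proof. by rewrite /srec /= eqxx; apply: F_local => j; exact: srec_tableE. Qed.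
End StrongRecursion.

(** * Series of operators in a small parameter *)

Section OperatorSeries.
Variables (R : realType) (n : nat).
Local Notation C := (R[i]).
Local Notation ps := (ps R n).
Implicit Types (p q : ps) (a b : mi n).

Definition gsum_ps (u : nat -> ps) (l : ps) := forall a, gsum (fun k => u k a) (l a).

Lemma gsum_psM p (u : nat -> ps) l : gsum_ps u l -> gsum_ps (fun k => p * u k) (p * l).
Proof.
move=> h a; have /= := @gsum_sum R _ (mi_below a)
  (fun b k => p b * u k (mi_sub a b)) (fun b => p b * l (mi_sub a b)) _.
by apply => b; apply: gsumZ; exact: h.
Qed.

Lemma gsum_ps_pderiv i (u : nat -> ps) l :
  gsum_ps u l -> gsum_ps (fun k => pderiv i (u k)) (pderiv i l).
Proof. by move=> h a; apply: gsumZ; exact: h. Qed.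

Lemma gsum_psD (u v : nat -> ps) l l' :
  gsum_ps u l -> gsum_ps v l' -> gsum_ps (fun k => u k + v k) (l + l').
Proof. by move=> h h' a; apply: gsumD; [exact: h | exact: h']. Qed.

Lemma gsum_ps_sum (I : Type) (s : seq I) (F : I -> nat -> ps) (l : I -> ps) :
  (forall i, gsum_ps (F i) (l i)) ->
  gsum_ps (fun k => \sum_(i <- s) F i k) (\sum_(i <- s) l i).
Proof.
move=> h a; rewrite pcoef_sum; apply: eq_gsum (gsum_sum s (fun i => h i a)) => k.
by rewrite pcoef_sum.
Qed.

(** Made total by the default 0; [series_opP] supplies the existence of the sum for tame operators
    and convergent series. *)
Definition gsum_val (u : nat -> C) : C :=
  if pselect (exists l, gsum u l) is left h then projT1 (cid h) else 0.

Lemma gsum_valE u l : gsum u l -> gsum_val u = l.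
Proof.
rewrite /gsum_val => h; case: pselect => [h'|[]]; last by exists l.
by apply: gsum_uniq h; exact: projT2 (cid h').
Qed.

(* [M] does not depend on the radius [r], so that a single small [s] makes
   [sum_k s ^ k L_k] converge on all convergent series. *)
Record tame (r0 M : R) (L : nat -> ps -> ps) : Prop := Tame {
  tameD : forall k p q, L k (p + q) = L k p + L k q;
  tameZ : forall k (c : C) q, L k (pC c * q) = pC c * L k q;
  tame_gsum : forall k u l, gsum_ps u l -> gsum_ps (fun m => L k (u m)) (L k l);
  tame_nrm : forall k r N q, 0 < r -> r <= r0 -> nrm r q N ->
    nrm (r / 2) (L k q) (M ^+ k * N) }.

Definition series_op (s : C) (L : nat -> ps -> ps) (q : ps) : ps :=
  fun a => gsum_val (fun k => s ^+ k * L k q a).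

Section Tame.
Variables (r0 M : R) (s : C).
Hypotheses (r0_gt0 : 0 < r0) (hs : cmod s * M <= 4^-1) (M0 : 0 <= M).

Lemma conv_small q : q \in conv -> exists r N, [/\ 0 < r, r <= r0 & nrm r q N].
Proof.
move=> /convP[r [N [r_gt0 h]]]; exists (Num.min r r0), N; split.
- by rewrite lt_min r_gt0.
- by rewrite ge_min lexx orbT.
- by apply: nrm_mono h; rewrite ?ge_min ?lexx// le_min !ltW.
Qed.

Lemma pow_small k : cmod s ^+ k * M ^+ k <= 4^-1 ^+ k.
Proof.
rewrite -exprMn lerXn2r// ?nnegrE ?mulr_ge0 ?cmod_ge0//; lra.
Qed.

Lemma tame_coef L q r N k a : tame r0 M L -> 0 < r -> r <= r0 -> nrm r q N ->
  cmod (s ^+ k * L k q a) <= N / (r / 2) ^+ mdegree a * 4^-1 ^+ k.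
Proof.
move=> tL r_gt0 hr hq; have := nrm_coef a (tame_nrm tL k r_gt0 hr hq).
have N0 := nrm_ge0 hq.
have rd : 0 < (r / 2) ^+ mdegree a by rewrite exprn_gt0// divr_gt0.
rewrite -ler_pdivlMr// cmodM cmodX => h.
apply: le_trans (ler_wpM2l (exprn_ge0 _ (cmod_ge0 s)) h) _.
rewrite mulrA mulrA [X in _ <= X]mulrC -mulrA ler_wpM2r ?pow_small//.
by rewrite divr_ge0// ltW.
Qed.

Lemma series_opP L q : tame r0 M L -> q \in conv ->
  gsum_ps (fun k => pC (s ^+ k) * L k q) (series_op s L q).
Proof.
move=> tL /conv_small[r [N [r_gt0 hr hq]]] a.
have [l hl] := gsum_ex (fun k => tame_coef k a tL r_gt0 hr hq).
rewrite /series_op (gsum_valE hl); apply: eq_gsum hl => k; by rewrite pcoefCM.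
Qed.

Lemma series_opE L q l : tame r0 M L -> q \in conv ->
  gsum_ps (fun k => pC (s ^+ k) * L k q) l -> series_op s L q = l.
Proof.
move=> tL hq hl; apply: psP => a.
exact: gsum_uniq (series_opP tL hq a) (hl a).
Qed.

Lemma series_op_conv L q : tame r0 M L -> q \in conv -> series_op s L q \in conv.
Proof.
move=> tL hq; have [r [N [r_gt0 hr hqr]]] := conv_small hq.
apply/asboolP/convergent_sup; exists (r / 2), (2 * N); split; first by rewrite divr_gt0.
move=> a; have rd : 0 < (r / 2) ^+ mdegree a by rewrite exprn_gt0// divr_gt0.
rewrite -ler_pdivlMr// -mulrA; apply: (gsum_norm (series_opP tL hq a)) => k.
by rewrite pcoefCM; apply: tame_coef.
Qed.

Lemma series_opD L p q : tame r0 M L -> p \in conv -> q \in conv ->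
  series_op s L (p + q) = series_op s L p + series_op s L q.
Proof.
move=> tL hp hq; apply: series_opE => //; first by rewrite rpredD.
move=> a; apply: eq_gsum (gsum_psD (series_opP tL hp) (series_opP tL hq) a) => k.
by rewrite (tameD tL) mulrDr.
Qed.

Lemma series_opZ L (c : C) q : tame r0 M L -> q \in conv ->
  series_op s L (pC c * q) = pC c * series_op s L q.
Proof.
move=> tL hq; apply: series_opE => //; first by rewrite rpredM ?conv_pC.
move=> a; apply: eq_gsum (gsum_psM (pC c) (series_opP tL hq) a) => k.
by rewrite (tameZ tL) mulrCA.
Qed.

(** The hypothesis on [L] is the Leibniz rule for the generating series; coefficientwise the claim
    is a finite sum of Cauchy products, each covered by [gsum_double]. *)
Lemma series_opM L p q : tame r0 M L ->
  (forall k p q, L k (p * q) = \sum_(i < k.+1) L i p * L (k - i)%N q) ->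
  p \in conv -> q \in conv ->
  series_op s L (p * q) = series_op s L p * series_op s L q.
Proof.
move=> tL LM hp hq; apply: series_opE => //; first by rewrite rpredM.
have [r [N [r_gt0 hr hpr]]] := conv_small hp.
have [r' [N' [r'_gt0 hr' hqr]]] := conv_small hq.
move=> a; pose u b k := s ^+ k * L k p b; pose v b k := s ^+ k * L k q b.
have hu b : gsum (u b) (series_op s L p b).
  by apply: eq_gsum (series_opP tL hp b) => k; rewrite pcoefCM.
have hv b : gsum (v b) (series_op s L q b).
  by apply: eq_gsum (series_opP tL hq b) => k; rewrite pcoefCM.
have hb b : gsum (fun m => \sum_(i < m.+1) u b i * v (mi_sub a b) (m - i)%N)
    (series_op s L p b * series_op s L q (mi_sub a b)).
  set B1 := N / (r / 2) ^+ mdegree b; set B2 := N' / (r' / 2) ^+ mdegree (mi_sub a b).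
  have b1 k : cmod (u b k) <= B1 * 4^-1 ^+ k by apply: tame_coef.
  have b2 k : cmod (v (mi_sub a b) k) <= B2 * 4^-1 ^+ k by apply: tame_coef.
  apply: (@gsum_double R (fun j k => u b j * v (mi_sub a b) k)
    (fun j => u b j * series_op s L q (mi_sub a b)) _ (B1 * B2)).
  - by move=> j k; rewrite cmodM exprD mulrACA ler_pM ?cmod_ge0.
  - by move=> j; apply: gsumZ.
  - rewrite mulrC; apply: eq_gsum (gsumZ (series_op s L q (mi_sub a b)) (hu b)) => k.
    by rewrite mulrC.
rewrite pcoefM; apply: eq_gsum (gsum_sum (mi_below a) hb) => k /=.
rewrite LM pcoefCM pcoef_sum exchange_big mulr_sumr/=; apply: eq_bigr => i _.
rewrite pcoefM mulr_sumr; apply: eq_bigr => b _; rewrite /u /v.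
have -> : s ^+ k = s ^+ i * s ^+ (k - i) by rewrite -exprD subnKC// -ltnS.
by ring.
Qed.

(** This evaluates the flow on the deformed series, where all terms of order at least 2 vanish. *)
Lemma series_op_fix L q p : tame r0 M L -> q \in conv ->
  L 0%N q = q -> L 1%N q = p -> (forall k, L k.+2 q = 0) ->
  series_op s L q = q + pC s * p.
Proof.
move=> tL hq h0 h1 h2; apply: series_opE => // a.
have /= := @gsum_finite R (fun k => (pC (s ^+ k) * L k q : ps) a) 2 _.
rewrite !big_ord_recr big_ord0/= add0r h0 h1 expr0 expr1 pC1 mul1r; apply.
by case=> [//|[//|k]] _; rewrite h2 mulr0.
Qed.

(** [tame_gsum] moves each L_i through the infinite sum; regrouping the L_i L'_k by i + k then
    leaves only index 0. Two tame operators in a row halve the radius twice, hence the bound [B]. *)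
Lemma series_op_cancel L L' q : tame r0 M L -> tame r0 M L' ->
  (forall q, L 0%N (L' 0%N q) = q) ->
  (forall k q, \sum_(i < k.+2) L i (L' (k.+1 - i)%N q) = 0) ->
  q \in conv -> series_op s L (series_op s L' q) = q.
Proof.
move=> tL tL' h0 hS hq; have hc := series_op_conv tL' hq.
have [r [N [r_gt0 hr hqr]]] := conv_small hq.
apply: psP => a.
pose w j k := s ^+ j * (s ^+ k * L j (L' k q) a).
set B := N / (r / 2 / 2) ^+ mdegree a.
have hw j k : cmod (w j k) <= B * 4^-1 ^+ (j + k).
  have r2 : 0 < r / 2 by rewrite divr_gt0.
  have r2r : r / 2 <= r0 by lra.
  have := tame_coef j a tL r2 r2r (tame_nrm tL' k r_gt0 hr hqr).
  rewrite /w mulrCA [cmod (s ^+ k * _)]cmodM cmodX => h.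
  apply: le_trans (ler_wpM2l (exprn_ge0 _ (cmod_ge0 s)) h) _.
  have -> : cmod s ^+ k * (M ^+ k * N / (r / 2 / 2) ^+ mdegree a * 4^-1 ^+ j) =
      cmod s ^+ k * M ^+ k * (B * 4^-1 ^+ j) by rewrite /B; ring.
  have -> : B * 4^-1 ^+ (j + k) = 4^-1 ^+ k * (B * 4^-1 ^+ j) by rewrite exprD; ring.
  rewrite ler_wpM2r ?pow_small// mulr_ge0 ?exprn_ge0 ?invr_ge0//.
  by rewrite divr_ge0 ?(nrm_ge0 hqr)// exprn_ge0// ltW// divr_gt0.
have hj j : gsum (w j) (s ^+ j * L j (series_op s L' q) a).
  apply: gsumZ; apply: eq_gsum (tame_gsum tL j (series_opP tL' hq) a) => k.
  by rewrite (tameZ tL) pcoefCM.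
have hl : gsum (fun j => s ^+ j * L j (series_op s L' q) a) (series_op s L (series_op s L' q) a).
  by apply: eq_gsum (series_opP tL hc a) => k; rewrite pcoefCM.
have h1 := gsum_double hw hj hl.
apply: gsum_uniq h1 _.
have := @gsum_finite R (fun m => \sum_(i < m.+1) w i (m - i)%N) 1 _.
rewrite big_ord_recr big_ord0/= add0r big_ord_recr big_ord0/= add0r subnn /w.
rewrite !expr0 !mul1r h0; apply; case=> // k _.
have -> : \sum_(i < k.+2) s ^+ i * (s ^+ (k.+1 - i) * L i (L' (k.+1 - i)%N q) a) =
   \sum_(i < k.+2) s ^+ k.+1 * L i (L' (k.+1 - i)%N q) a.
  apply: eq_bigr => i _; rewrite mulrA -exprD subnKC//.
  by rewrite -ltnS.
by rewrite -mulr_sumr; have := congr1 (fun f : ps => f a) (hS k q); rewrite /= pcoef_sum => ->; rewrite mulr0.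
Qed.

End Tame.
End OperatorSeries.

Section FlowBounds.
Variable R : realType.
Implicit Types (r K c M : R).

Lemma bernoulli (x : R) j : 0 <= x -> x <= 1 -> 1 - j%:R * x <= (1 - x) ^+ j.
Proof.
move=> x0 x1; elim: j => [|j IH]; first by rewrite mul0r subr0 expr0.
rewrite exprS; apply: le_trans (ler_wpM2l _ IH); last by lra.
rewrite -natr1; have : 0 <= j%:R * x ^+ 2 by rewrite mulr_ge0// sqr_ge0.
by rewrite expr2; lra.
Qed.

(** Bernoulli's inequality applied directly gives only 1/(j + 1). Bounding the base below by a
    square first makes each of the two factors at least 1/4, uniformly in [j]. *)
Lemma shrink_pow_ge j : 16^-1 <= (1 - j.+1%:R^-1 : R) ^+ j.
Proof.
case: j => [|j]; first by rewrite expr0; lra.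
set y := j.+2%:R^-1.
have j2 : (2 : R) <= j.+2%:R by rewrite (ler_nat R 2).
have y0 : 0 <= y by rewrite invr_ge0.
have y1 : y <= 2^-1 by rewrite lef_pV2// ?posrE; lra.
have hz : (1 - 3/4 * y) ^+ 2 <= 1 - y by rewrite expr2; nra.
apply: (@le_trans _ _ ((1 - 3/4 * y) ^+ 2 ^+ j.+1)); last first.
  by rewrite lerXn2r// ?nnegrE ?sqr_ge0//; lra.
rewrite exprAC; have h : 4^-1 <= (1 - 3/4 * y) ^+ j.+1.
  apply: le_trans (bernoulli j.+1 _ _); [|lra|lra].
  have : j.+1%:R * y <= 1 by rewrite /y ler_pdivrMr// mul1r ler_nat.
  by lra.
by rewrite expr2; nra.
Qed.

(** Giving one derivation the share 1/(j + 1) of the gap of radii costs the other j steps only a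
    bounded factor. *)
Lemma shrink_ratio r r' j : 0 < r -> r <= r' -> (0 < j)%N -> r < r' ->
  (r' / ((r' - r) * (1 - j.+1%:R^-1))) ^+ j <= 16 * (r' / (r' - r)) ^+ j.
Proof.
move=> r0 rr j0 rlt; have h := shrink_pow_ge j.
rewrite invfM mulrA exprMn mulrC ler_wpM2r ?exprn_ge0 ?divr_ge0//; try lra.
rewrite exprVn -[16]invrK lef_pV2// posrE; lra.
Qed.

(** This closes the induction for the flow bounds: 2 c <= M keeps the convolution below 2 M^k, and
    32 K is this 2 times the 16 of [shrink_ratio]. *)
Lemma geom_convolution_le K c M k : 0 <= K -> 0 <= c -> 0 < M ->
  2 * c <= M -> 32 * K <= M ->
  \sum_(i < k.+1) 16 * K * c ^+ (k - i) * M ^+ i <= M ^+ k.+1.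
Proof.
move=> K0 c0 M0 cM KM.
have h : \sum_(i < k.+1) c ^+ (k - i) * M ^+ i <= 2 * M ^+ k.
  elim: k => [|k IH]; first by rewrite big_ord_recr big_ord0/= subnn !expr0; lra.
  rewrite big_ord_recr/= subnn expr0 mul1r.
  have -> : \sum_(i < k.+1) c ^+ (k.+1 - i) * M ^+ i = c * \sum_(i < k.+1) c ^+ (k - i) * M ^+ i.
    rewrite mulr_sumr; apply: eq_bigr => i _; rewrite subSn ?exprS ?mulrA//.
    by rewrite -ltnS.
  have Mk : 0 <= M ^+ k by rewrite exprn_ge0// ltW.
  have := ler_wpM2l c0 IH; rewrite exprS; nra.
under eq_bigr do rewrite -mulrA.
rewrite -mulr_sumr exprS; have Mk : 0 <= M ^+ k by rewrite exprn_ge0// ltW.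
apply: (@le_trans _ _ (16 * K * (2 * M ^+ k))); first by rewrite ler_wpM2l// mulr_ge0.
by rewrite mulrA ler_wpM2r//; lra.
Qed.
End FlowBounds.

Section Flow.
Variables (R : realType) (n : nat).
Local Notation C := (R[i]).
Local Notation ps := (ps R n).
Implicit Types (p q : ps) (r N : R).
Variable X : nat -> ps -> ps.
Hypothesis XD : forall k p q, X k (p + q) = X k p + X k q.
Hypothesis XZ : forall k (c : C) q, X k (pC c * q) = pC c * X k q.
Hypothesis XM : forall k p q, X k (p * q) = X k p * q + p * X k q.
Hypothesis X_gsum : forall k u l, gsum_ps u l -> gsum_ps (fun m => X k (u m)) (X k l).
Variables r0 K c M : R.
Hypotheses (K0 : 0 <= K) (c0 : 0 <= c) (M0 : 0 < M) (cM : 2 * c <= M) (KM : 32 * K <= M).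
(** The numerator [r] reflects that the field vanishes at the origin. It makes the bound depend only
    on the ratio of the radii, as [tame] requires. *)
Hypothesis X_nrm : forall k q r r' N, 0 < r -> r < r' -> r' <= r0 -> nrm r' q N ->
  nrm r (X k q) (K * c ^+ k * (r / (r' - r)) * N).

Lemma field0 k : X k 0 = 0.
Proof. by have := XZ k 0 0; rewrite pC0 !mul0r. Qed.
Lemma field_sum k (I : Type) (s : seq I) (P : pred I) (G : I -> ps) :
  X k (\sum_(i <- s | P i) G i) = \sum_(i <- s | P i) X k (G i).
Proof. exact: (big_morph (X k) (XD k) (field0 k)). Qed.

(* [flow k] and [flow_inv k] are the coefficients of [t ^ k] in the solutions of
   [Phi' = X(t) o Phi] and [Psi' = - Psi o X(t)] with [Phi(0) = Psi(0) = id],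
   for the time-dependent vector field [X(t) = sum_k t ^ k X_k]. *)
Definition flow k q : ps :=
  srec q (fun k u => pC k.+1%:R^-1 * \sum_(i < k.+1) X (k - i) (u i)) k.

Definition flow_inv : nat -> ps -> ps :=
  srec id (fun k u q => - (pC k.+1%:R^-1 * \sum_(i < k.+1) u i (X (k - i)%N q))).

Lemma flow0 q : flow 0 q = q. Proof. by []. Qed.
Lemma flowS k q :
  flow k.+1 q = pC k.+1%:R^-1 * \sum_(i < k.+1) X (k - i) (flow i q).
Proof.
rewrite /flow srecS// => m u v h; congr (_ * _); apply: eq_bigr => i _.
by rewrite h// -ltnS.
Qed.
Lemma flow_inv0 q : flow_inv 0 q = q. Proof. by []. Qed.
Lemma flow_invS k q :
  flow_inv k.+1 q = - (pC k.+1%:R^-1 * \sum_(i < k.+1) flow_inv i (X (k - i)%N q)).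
Proof.
rewrite /flow_inv srecS// => m u v h; apply: functional_extensionality_dep => p.
congr (- (_ * _)); apply: eq_bigr => i _.
by rewrite h// -ltnS.
Qed.

Lemma pC_natK k : pC (k.+1%:R : C) * pC k.+1%:R^-1 = 1 :> ps.
Proof. by rewrite -pCM divff ?pC1// pnatr_eq0. Qed.
Lemma pC_nat k : pC (k%:R : C) = k%:R :> ps.
Proof. exact: (rmorph_nat (@pC R n)). Qed.
Lemma natM_inj k p q : k.+1%:R * p = k.+1%:R * q -> p = q.
Proof.
have e (x : ps) : x = pC k.+1%:R^-1 * (k.+1%:R * x).
  by rewrite -pC_nat mulrA [pC _^-1 * _]mulrC pC_natK mul1r.
by move=> h; rewrite (e p) h -e.
Qed.
Lemma flowS_nat k q : k.+1%:R * flow k.+1 q = \sum_(i < k.+1) X (k - i) (flow i q).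
Proof. by rewrite flowS mulrA -pC_nat pC_natK mul1r. Qed.
Lemma flow_invS_nat k q :
  k.+1%:R * flow_inv k.+1 q = - \sum_(i < k.+1) flow_inv i (X (k - i)%N q).
Proof. by rewrite flow_invS mulrN mulrA -pC_nat pC_natK mul1r. Qed.

Lemma flowD k p q : flow k (p + q) = flow k p + flow k q.
Proof.
elim/ltn_ind: k => -[|k] IH//; rewrite !flowS -mulrDr -big_split/=; congr (_ * _).
by apply: eq_bigr => i _; rewrite IH ?XD.
Qed.
Lemma flowZ k (a : C) q : flow k (pC a * q) = pC a * flow k q.
Proof.
elim/ltn_ind: k => -[|k] IH//; rewrite !flowS mulrCA [in RHS]mulr_sumr; congr (_ * _).
by apply: eq_bigr => i _; rewrite IH ?XZ.
Qed.
Lemma flow_gsum k u l : gsum_ps u l -> gsum_ps (fun m => flow k (u m)) (flow k l).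
Proof.
elim/ltn_ind: k => -[|k] IH// h a; rewrite flowS.
apply: (@eq_gsum R (fun m => (pC k.+1%:R^-1 * \sum_(i < k.+1) X (k - i) (flow i (u m)) : ps) a)).
  by move=> m; rewrite flowS.
apply: (gsum_psM _ _ a) => {}a; apply: gsum_ps_sum => i.
by apply: X_gsum; apply: IH.
Qed.
Lemma flow_invD k p q : flow_inv k (p + q) = flow_inv k p + flow_inv k q.
Proof.
elim/ltn_ind: k p q => -[|k] IH// p q; rewrite !flow_invS -opprD -mulrDr -big_split/=.
by congr (- (_ * _)); apply: eq_bigr => i _; rewrite XD IH.
Qed.
Lemma flow_invZ k (a : C) q : flow_inv k (pC a * q) = pC a * flow_inv k q.
Proof.
elim/ltn_ind: k q => -[|k] IH// q; rewrite !flow_invS mulrN mulrCA [in RHS]mulr_sumr.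
by congr (- (_ * _)); apply: eq_bigr => i _; rewrite XZ IH.
Qed.
Lemma flow_inv_gsum k u l :
  gsum_ps u l -> gsum_ps (fun m => flow_inv k (u m)) (flow_inv k l).
Proof.
elim/ltn_ind: k u l => -[|k] IH// u l h a; rewrite flow_invS -mulNr -pCN.
apply: (@eq_gsum R (fun m =>
    (pC (- k.+1%:R^-1) * \sum_(i < k.+1) flow_inv i (X (k - i)%N (u m)) : ps) a)).
  by move=> m; rewrite flow_invS -mulNr -pCN.
apply: (gsum_psM _ _ a) => {}a; apply: gsum_ps_sum => i.
by apply: IH => //; apply: X_gsum.
Qed.

Lemma rev_sub j k (w : nat -> ps) : (j <= k)%N ->
  \sum_(l < k.+1 - j) w l = \sum_(l < k.+1 - j) w (k - j - l)%N.
Proof.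
move=> jk; rewrite (reindex_inj rev_ord_inj)/=; apply: eq_bigr => l _; congr w.
by have := ltn_ord l; lia.
Qed.

(** As the X_k are derivations, both sides satisfy the same recursion in k; this is the coefficient
    form of d/dt (Phi p * Phi q) = X (Phi p * Phi q). *)
Lemma flowM k p q : flow k (p * q) = \sum_(i < k.+1) flow i p * flow (k - i)%N q.
Proof.
elim/ltn_ind: k => -[|k] IH; first by rewrite big_ord_recr big_ord0/= add0r !flow0.
apply: (@natM_inj k); rewrite flowS_nat.
have -> : \sum_(i < k.+1) X (k - i) (flow i (p * q)) =
   \sum_(j < k.+1) \sum_(l < k.+1 - j) X (k - j - l)%N (flow j p) * flow l q +
   \sum_(j < k.+1) \sum_(l < k.+1 - j) flow j p * X (k - j - l)%N (flow l q).
  rewrite -!(sum_triangle (fun j l => X (k - j - l)%N (flow j p) * flow l q)).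
  rewrite -!(sum_triangle (fun j l => flow j p * X (k - j - l)%N (flow l q))).
  rewrite -big_split/=; apply: eq_bigr => i _; rewrite IH// field_sum -big_split/=.
  apply: eq_bigr => j _; rewrite XM.
  by have -> : (k - j - (i - j) = k - i)%N by have := ltn_ord j; have := ltn_ord i; lia.
rewrite mulr_sumr.
(* Splitting k + 1 as i + (k + 1 - i) differentiates either the left or the right factor. *)
transitivity (\sum_(i < k.+2) (i%:R * flow i p) * flow (k.+1 - i)%N q +
   \sum_(i < k.+2) flow i p * ((k.+1 - i)%:R * flow (k.+1 - i)%N q)); last first.
  rewrite -big_split/=; apply: eq_bigr => i _.
  rewrite [flow i p * (_ * _)]mulrCA -!mulrA -mulrDl -natrD subnKC//; by rewrite -ltnS.
congr (_ + _).
  rewrite [RHS]big_ord_recl/= !mul0r add0r.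
  under [RHS]eq_bigr => i _ do rewrite /bump leq0n add1n flowS_nat subSS mulr_suml.
  pose w j l := X l (flow j p) * flow (k - (j + l))%N q.
  transitivity (\sum_(i < k.+1) \sum_(j < i.+1) w j (i - j)%N); last first.
    apply: eq_bigr => i _; apply: eq_bigr => j _ /=.
    by rewrite /w subnKC// -ltnS.
  rewrite (sum_triangle w); apply: eq_bigr => j _; rewrite rev_sub; last by rewrite -ltnS.
  apply: eq_bigr => l _.
  congr (_ * flow _ _); by have := ltn_ord j; have := ltn_ord l; lia.
rewrite [RHS]big_ord_recr/= subnn mul0r mulr0 addr0; apply: eq_bigr => j _.
have hj : (j <= k)%N by rewrite -ltnS.
by rewrite -mulr_sumr subSn// flowS_nat.
Qed.

Lemma flow_sum k (I : Type) (s : seq I) (G : I -> ps) :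
  flow k (\sum_(i <- s) G i) = \sum_(i <- s) flow k (G i).
Proof.
have h0 : flow k 0 = 0 by have := flowZ k 0 0; rewrite pC0 !mul0r.
exact: (big_morph (flow k) (flowD k) h0).
Qed.
Lemma flow_inv_sum k (I : Type) (s : seq I) (G : I -> ps) :
  flow_inv k (\sum_(i <- s) G i) = \sum_(i <- s) flow_inv k (G i).
Proof.
have h0 : flow_inv k 0 = 0 by have := flow_invZ k 0 0; rewrite pC0 !mul0r.
exact: (big_morph (flow_inv k) (flow_invD k) h0).
Qed.
Lemma flow_natM k m q : flow k (m%:R * q) = m%:R * flow k q.
Proof. by rewrite -!pC_nat flowZ. Qed.
Lemma flow_inv_natM k m q : flow_inv k (m%:R * q) = m%:R * flow_inv k q.
Proof. by rewrite -!pC_nat flow_invZ. Qed.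
Lemma flow_opp k q : flow k (- q) = - flow k q.
Proof. by have := flowZ k (-1) q; rewrite pCN pC1 !mulN1r. Qed.

Lemma nat_split_sum k (w : nat -> ps) :
  k.+1%:R * \sum_(i < k.+2) w i =
  \sum_(i < k.+1) i.+1%:R * w i.+1 + \sum_(i < k.+1) (k.+1 - i)%:R * w i.
Proof.
transitivity (\sum_(i < k.+2) i%:R * w i + \sum_(i < k.+2) (k.+1 - i)%:R * w i).
  rewrite -big_split mulr_sumr; apply: eq_bigr => i _ /=.
  by rewrite -mulrDl -natrD subnKC// -ltnS.
congr (_ + _); first by rewrite big_ord_recl mul0r add0r.
by rewrite big_ord_recr/= subnn mul0r addr0.
Qed.

(** The derivative of Psi o Phi is - Psi X Phi + Psi X Phi = 0, read off at one power of t; no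
    induction is involved. *)
Lemma flow_invK k q : \sum_(i < k.+2) flow_inv i (flow (k.+1 - i) q) = 0.
Proof.
apply: (@natM_inj k); rewrite mulr0 (nat_split_sum k (fun i => flow_inv i (flow (k.+1 - i) q))).
apply/eqP; rewrite addr_eq0; apply/eqP.
pose w j l := flow_inv j (X l (flow (k - (j + l)) q)).
transitivity (- \sum_(i < k.+1) \sum_(j < i.+1) w j (i - j)%N).
  rewrite -sumrN; apply: eq_bigr => i _; rewrite flow_invS_nat subSS; congr (- _).
  by apply: eq_bigr => j _; rewrite /w subnKC// -ltnS.
rewrite (sum_triangle w); congr (- _); apply: eq_bigr => i _.
have hi : (i <= k)%N by rewrite -ltnS.
rewrite -flow_inv_natM subSn// flowS_nat flow_inv_sum -subSn// [LHS]rev_sub//.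
apply: eq_bigr => l _; rewrite /w; congr (flow_inv _ (X _ (flow _ _))).
by have := ltn_ord l; lia.
Qed.

(** In this order the derivative is X (Phi Psi) - (Phi Psi) X, which vanishes only once Phi Psi is
    known to be the identity in lower degrees. Hence the induction, after which both terms reduce to
    X_k. *)
Lemma flowK k q : \sum_(i < k.+2) flow i (flow_inv (k.+1 - i)%N q) = 0.
Proof.
elim/ltn_ind: k q => k IH q.
have W m p : (m <= k)%N ->
    \sum_(j < m.+1) flow j (flow_inv (m - j)%N p) = if m == 0%N then p else 0.
  case: m => [|m] hm; last by rewrite IH.
  by rewrite big_ord_recr big_ord0/= add0r.
have Wk (H : nat -> ps) : (forall m, (0 < m)%N -> H m = 0) -> \sum_(m < k.+1) H m = H 0%N.
  by move=> h; rewrite big_ord_recl big1 ?addr0// => i _; rewrite h.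
apply: (@natM_inj k).
rewrite mulr0 (nat_split_sum k (fun i => flow i (flow_inv (k.+1 - i)%N q))).
apply/eqP; rewrite addr_eq0; apply/eqP.
transitivity (X k q).
  pose w j l := X l (flow j (flow_inv (k - (j + l))%N q)).
  transitivity (\sum_(i < k.+1) \sum_(j < i.+1) w j (i - j)%N).
    apply: eq_bigr => i _; rewrite flowS_nat subSS.
    by apply: eq_bigr => j _; rewrite /w subnKC// -ltnS.
  rewrite (sum_triangle w).
  pose v j l := X (k - (j + l))%N (flow j (flow_inv l q)).
  transitivity (\sum_(j < k.+1) \sum_(l < k.+1 - j) v j l).
    apply: eq_bigr => j _; rewrite rev_sub; last by rewrite -ltnS.
    apply: eq_bigr => l _; rewrite /w /v.
    congr (X _ (flow _ (flow_inv _ q))); have := ltn_ord l; have := ltn_ord j; lia.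
  rewrite -(sum_triangle v).
  transitivity (\sum_(m < k.+1) X (k - m)%N (if m == 0%N :> nat then q else 0)).
    apply: eq_bigr => m _; rewrite -(W m) ?field_sum; last by rewrite -ltnS.
    by apply: eq_bigr => j _; rewrite /v subnKC// -ltnS.
  rewrite (Wk (fun m => X (k - m)%N (if m == 0%N :> nat then q else 0))) ?subn0//.
  by move=> [|m]//= _; rewrite field0.
apply/eqP; rewrite -eqr_oppLR; apply/eqP/esym.
pose v j l := flow j (flow_inv l (X (k - (j + l))%N q)).
transitivity (- \sum_(j < k.+1) \sum_(l < k.+1 - j) v j l).
  rewrite -sumrN; apply: eq_bigr => j _.
  have hj : (j <= k)%N by rewrite -ltnS.
  rewrite -flow_natM subSn// flow_invS_nat flow_opp flow_sum; congr (- _).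
  by apply: eq_bigr => l _; rewrite /v subnDA.
rewrite -(sum_triangle v); congr (- _).
transitivity (\sum_(m < k.+1) (if m == 0%N :> nat then X (k - m)%N q else 0)).
  apply: eq_bigr => m _; rewrite -(W m) ?field_sum; last by rewrite -ltnS.
  by apply: eq_bigr => j _; rewrite /v subnKC// -ltnS.
by rewrite (Wk (fun m => if m == 0%N :> nat then X (k - m)%N q else 0)) ?subn0//; case.
Qed.

(** Shared by both flows: [x] is the cost of one derivation, [y] that of the [i] others. The loss i
    + 1 is at most k + 1, which the recursion divides out. *)
Lemma flow_step_bound r r' (x y N : R) i k : 0 < r -> r < r' -> 0 <= N -> (i <= k)%N ->
  0 <= x -> x <= i.+1%:R * (r' / (r' - r)) ->
  0 <= y -> y <= 16 * (r' / (r' - r)) ^+ i ->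
  K * c ^+ (k - i) * x * (M ^+ i * y * N) <=
  k.+1%:R * (16 * K * c ^+ (k - i) * M ^+ i) * ((r' / (r' - r)) ^+ k.+1 * N).
Proof.
move=> hr rr N0 ik x0 hx y0 hy; set T := r' / (r' - r) in hx hy *.
have T1 : 1 <= T by rewrite /T ler_pdivlMr; lra.
have T0 : 0 <= T by lra.
set A := K * c ^+ (k - i) * M ^+ i * N.
have A0 : 0 <= A by rewrite !mulr_ge0// exprn_ge0// ltW.
have -> : K * c ^+ (k - i) * x * (M ^+ i * y * N) = A * (x * y) by rewrite /A; ring.
have -> : k.+1%:R * (16 * K * c ^+ (k - i) * M ^+ i) * (T ^+ k.+1 * N) =
  A * (k.+1%:R * (16 * T ^+ k.+1)) by rewrite /A; ring.
rewrite ler_wpM2l//; apply: le_trans (ler_pM x0 y0 hx hy) _.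
have -> : i.+1%:R * T * (16 * T ^+ i) = i.+1%:R * (16 * T ^+ i.+1) by rewrite exprS; ring.
apply: ler_pM; rewrite ?mulr_ge0 ?exprn_ge0 ?ler_nat//.
by rewrite ler_wpM2l//; apply: ler_weXn2l.
Qed.

Lemma flow_sum_bound r r' N k (F : 'I_k.+1 -> ps) : 0 < r -> r < r' -> 0 <= N ->
  (forall i, nrm r (F i) (k.+1%:R * (16 * K * c ^+ (k - i) * M ^+ i) *
                          ((r' / (r' - r)) ^+ k.+1 * N))) ->
  nrm r (pC k.+1%:R^-1 * \sum_(i < k.+1) F i) (M ^+ k.+1 * (r' / (r' - r)) ^+ k.+1 * N).
Proof.
move=> hr rr N0 h.
have hS := nrmZ (k.+1%:R^-1) (nrm_sum (index_enum _) (ltW hr) (fun i (_ : predT i) => h i)).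
apply: nrm_le hS; rewrite cmodV cmod_nat -mulr_suml -mulr_sumr -!mulrA mulKf ?pnatr_eq0//.
rewrite ler_wpM2r//; last exact: geom_convolution_le.
by rewrite mulr_ge0// exprn_ge0// divr_ge0//; lra.
Qed.

(** Equal radii are allowed for k = 0, where the operator is the identity: the summand i = 0 of the
    induction step uses exactly this case. *)
Lemma flow_nrm k r r' q N : 0 < r -> r <= r' -> r' <= r0 -> ((0 < k)%N -> r < r') ->
  nrm r' q N -> nrm r (flow k q) (M ^+ k * (r' / (r' - r)) ^+ k * N).
Proof.
elim/ltn_ind: k r => -[|k] IH r hr rr rr0 hk hq.
  by rewrite flow0 !expr0 !mul1r; apply: nrm_mono hq => //; exact: ltW.
have rlt := hk isT; have N0 := nrm_ge0 hq.
rewrite flowS; apply: flow_sum_bound => // i.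
have ik : (i <= k)%N by rewrite -ltnS.
have i1 : 1 <= i.+1%:R :> R by rewrite ler1n.
(* [flow i] acts first and uses i/(i + 1) of the gap from r' down to rho; the outer derivation gets
   the remaining share 1/(i + 1). *)
pose y : R := i.+1%:R^-1; pose rho := r + (r' - r) * y.
have y0 : 0 < y by rewrite invr_gt0; lra.
have y1 : y <= 1 by rewrite invf_le1; lra.
have dy : 0 < (r' - r) * y by rewrite mulr_gt0; lra.
have dy1 : (r' - r) * y <= r' - r by rewrite ler_piMr; lra.
have yi : (0 < i)%N -> rho < r'.
  move=> i0; suff : (r' - r) * y < r' - r by rewrite /rho; lra.
  rewrite gtr_pMr ?subr_gt0// invf_lt1 ?ltr1n//; lra.
have h1 : nrm rho (flow i q) (M ^+ i * (r' / (r' - rho)) ^+ i * N).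
  by apply: IH => //; rewrite /rho; lra.
have h2 : nrm r (X (k - i) (flow i q))
    (K * c ^+ (k - i) * (r / (rho - r)) * (M ^+ i * (r' / (r' - rho)) ^+ i * N)).
  by apply: X_nrm h1; rewrite /rho; lra.
have rhor : rho - r = (r' - r) * y by rewrite /rho; ring.
apply: nrm_le h2; apply: flow_step_bound => //.
- by rewrite divr_ge0// ?rhor ltW.
- have -> : r / (rho - r) = i.+1%:R * (r / (r' - r)) by rewrite rhor /y invfM invrK; ring.
  by rewrite ler_wpM2l ?ler_wpM2r ?invr_ge0//; lra.
- by rewrite exprn_ge0// divr_ge0//; rewrite /rho; lra.
- case: (posnP i) => [->|i0]; first by rewrite !expr0; lra.
  have -> : r' - rho = (r' - r) * (1 - y) by rewrite /rho; ring.
  exact: shrink_ratio.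
Qed.

Lemma flow_inv_nrm k r r' q N : 0 < r -> r <= r' -> r' <= r0 -> ((0 < k)%N -> r < r') ->
  nrm r' q N -> nrm r (flow_inv k q) (M ^+ k * (r' / (r' - r)) ^+ k * N).
Proof.
elim/ltn_ind: k r r' q N => -[|k] IH r r' q N hr rr rr0 hk hq.
  by rewrite flow_inv0 !expr0 !mul1r; apply: nrm_mono hq => //; exact: ltW.
have rlt := hk isT; have N0 := nrm_ge0 hq.
rewrite flow_invS; apply: nrmN; apply: flow_sum_bound => // i.
have ik : (i <= k)%N by rewrite -ltnS.
have i1 : 1 <= i.+1%:R :> R by rewrite ler1n.
(* Here the derivation acts first, so its share 1/(i + 1) is taken at the outer end of the gap. *)
pose y : R := i.+1%:R^-1; pose rho := r' - (r' - r) * y.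
have y0 : 0 < y by rewrite invr_gt0; lra.
have y1 : y <= 1 by rewrite invf_le1; lra.
have dy : 0 < (r' - r) * y by rewrite mulr_gt0; lra.
have dy1 : (r' - r) * y <= r' - r by rewrite ler_piMr; lra.
have yi : (0 < i)%N -> r < rho.
  move=> i0; suff : (r' - r) * y < r' - r by rewrite /rho; lra.
  rewrite gtr_pMr ?subr_gt0// invf_lt1 ?ltr1n//; lra.
have h1 : nrm rho (X (k - i) q) (K * c ^+ (k - i) * (rho / (r' - rho)) * N).
  by apply: X_nrm hq => //; rewrite /rho; lra.
have h2 : nrm r (flow_inv i (X (k - i)%N q)) (M ^+ i * (rho / (rho - r)) ^+ i *
    (K * c ^+ (k - i) * (rho / (r' - rho)) * N)).
  by apply: IH h1 => //; rewrite /rho; lra.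
have rhor : r' - rho = (r' - r) * y by rewrite /rho; ring.
have rho0 : 0 < rho by rewrite /rho; lra.
apply: nrm_le h2.
have -> : M ^+ i * (rho / (rho - r)) ^+ i * (K * c ^+ (k - i) * (rho / (r' - rho)) * N) =
  K * c ^+ (k - i) * (rho / (r' - rho)) * (M ^+ i * (rho / (rho - r)) ^+ i * N) by ring.
have d0 : 0 <= rho - r by rewrite /rho; lra.
apply: flow_step_bound => //.
- by rewrite divr_ge0// ?rhor ltW.
- have -> : rho / (r' - rho) = i.+1%:R * (rho / (r' - r)) by rewrite rhor /y invfM invrK; ring.
  by rewrite ler_wpM2l ?ler_wpM2r ?invr_ge0//; rewrite /rho; lra.
- by rewrite exprn_ge0// divr_ge0// ltW.
- case: (posnP i) => [->|i0]; first by rewrite !expr0; lra.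
  apply: le_trans (shrink_ratio hr rr i0 rlt).
  have dE : rho - r = (r' - r) * (1 - y) by rewrite /rho; ring.
  rewrite -dE lerXn2r// ?nnegrE ?divr_ge0//; try lra.
  by rewrite ler_wpM2r ?invr_ge0// /rho; lra.
Qed.

Lemma half_ratio r : 0 < r -> r / (r - r / 2) = 2.
Proof. by move=> h; field; rewrite gt_eqF//; lra. Qed.

Lemma tame_flow : tame r0 (2 * M) flow.
Proof.
split; [exact: flowD | exact: flowZ | exact: flow_gsum |].
move=> k r N q hr rr hq; have := @flow_nrm k (r / 2) r q N.
rewrite half_ratio// -exprMn [M * 2]mulrC; apply => //; lra.
Qed.

Lemma tame_flow_inv : tame r0 (2 * M) flow_inv.
Proof.
split; [exact: flow_invD | exact: flow_invZ | exact: flow_inv_gsum |].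
move=> k r N q hr rr hq; have := @flow_inv_nrm k (r / 2) r q N.
rewrite half_ratio// -exprMn [M * 2]mulrC; apply => //; lra.
Qed.

Lemma field1 k : X k 1 = 0.
Proof.
have := XM k 1 1; rewrite !mulr1 mul1r => /eqP.
by rewrite -subr_eq0 opprD addNKr oppr_eq0 => /eqP.
Qed.

Lemma flow1 k : flow k.+1 1 = 0.
Proof.
elim/ltn_ind: k => k IH; rewrite flowS big1 ?mulr0// => i _.
by case: i => -[|i] hi /=; rewrite ?flow0 ?field1// IH// field0.
Qed.

Hypothesis r0_gt0 : 0 < r0.

Lemma flow_automorphism s : cmod s * (2 * M) <= 4^-1 ->
  is_automorphism (series_op s flow).
Proof.
move=> hs; have M2 : 0 <= 2 * M by rewrite mulr_ge0// ltW.
have cE f : convergent f <-> f \in conv by split=> [h|/asboolP//]; apply/asboolP.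
have tF := tame_flow; have tI := tame_flow_inv.
have can1 q : q \in conv -> series_op s flow_inv (series_op s flow q) = q.
  by apply: (series_op_cancel r0_gt0 hs M2 tI tF) => // k p; exact: flow_invK.
have can2 q : q \in conv -> series_op s flow (series_op s flow_inv q) = q.
  by apply: (series_op_cancel r0_gt0 hs M2 tF tI) => // k p; exact: flowK.
split; [|split; [|split; [|split; [|split; [|split]]]]].
- by move=> f /cE hf; apply/cE; exact: (series_op_conv r0_gt0 hs M2 tF).
- by move=> f g /cE hf /cE hg; exact: (series_opD r0_gt0 hs M2 tF).
- move=> f g /cE hf /cE hg; apply: (series_opM r0_gt0 hs M2 tF) => // k p q.
  exact: flowM.
- by move=> a f /cE hf; rewrite !pscaleE; exact: (series_opZ r0_gt0 hs M2 _ tF).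
- have := @series_op_fix _ _ _ _ _ r0_gt0 hs M2 flow 1 0 tF (rpred1 _).
  rewrite mulr0 addr0; apply=> [//||k]; exact: flow1.
- by move=> f g /cE hf /cE hg h; rewrite -(can1 f)// h can1.
- move=> g /cE hg; exists (series_op s flow_inv g); split; last exact: can2.
  by apply/cE; exact: (series_op_conv r0_gt0 hs M2 tI).
Qed.

End Flow.

(** * Right equivalence by Moser's path method *)

Section FlowEquivalence.
Variables (R : realType) (n : nat).
Local Notation C := (R[i]).
Local Notation ps := (ps R n).

Lemma conv_family (I : finType) (F : I -> ps) : (forall i, F i \in conv) ->
  exists r M, [/\ 0 < r, 0 <= M & forall i, nrm r (F i) M].
Proof.
move=> hF; suff [r [M [r0 M0 h]]] : exists r M, [/\ 0 < r, 0 <= M &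
    forall i, i \in enum I -> nrm r (F i) M].
  by exists r, M; split => // i; apply: h; rewrite mem_enum.
elim: (enum I) => [|i s [r [M [r0 M0 h]]]]; first by exists 1, 0.
have /convP[r' [M' [r'0 h']]] := hF i.
exists (Num.min r r'), (Num.max M M'); split.
- by rewrite lt_min r0.
- by rewrite le_max M0.
move=> j; rewrite inE => /orP[/eqP ->|/h hj].
  apply: (@nrm_le _ _ _ _ M'); first by rewrite le_max lexx orbT.
  by apply: nrm_mono h'; rewrite ?ge_min ?lexx ?orbT// le_min !ltW.
apply: (@nrm_le _ _ _ _ M); first by rewrite le_max lexx.
by apply: nrm_mono hj; rewrite ?ge_min ?lexx// le_min !ltW.
Qed.

Section VectorField.
Variables (a : 'I_n -> ps) (Cm : 'I_n -> 'I_n -> ps).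

(* The coefficients of [t ^ k] of the vector [(1 + t Cm)^-1 a] (acting on the right). *)
Fixpoint field_coef k : 'I_n -> ps :=
  if k is k'.+1 then fun j => - \sum_i field_coef k' i * Cm i j else a.

Definition field_op k (q : ps) : ps := \sum_j field_coef k j * pderiv j q.

Lemma field_opD k p q : field_op k (p + q) = field_op k p + field_op k q.
Proof. by rewrite -big_split; apply: eq_bigr => j _; rewrite pderivD mulrDr. Qed.
Lemma field_opZ k (c : C) q : field_op k (pC c * q) = pC c * field_op k q.
Proof. by rewrite mulr_sumr; apply: eq_bigr => j _; rewrite pderivCM mulrCA. Qed.
Lemma field_opM k p q : field_op k (p * q) = field_op k p * q + p * field_op k q.
Proof.
rewrite mulr_suml mulr_sumr -big_split; apply: eq_bigr => j _ /=.
by rewrite pderivM; ring.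
Qed.
Lemma field_op_gsum k u l : gsum_ps u l -> gsum_ps (fun m => field_op k (u m)) (field_op k l).
Proof. by move=> h; apply: gsum_ps_sum => j; apply/gsum_psM/gsum_ps_pderiv. Qed.

(** One more factor [Cm] turns the derivatives of [g] into those of [h]. This is the cancellation
    that makes the flow of [g] affine in t. *)
Lemma field_opS (g h : ps) k : (forall i, pderiv i h = \sum_j Cm i j * pderiv j g) ->
  field_op k.+1 g = - field_op k h.
Proof.
move=> hC; rewrite /field_op /=.
transitivity (- \sum_j \sum_i field_coef k i * Cm i j * pderiv j g).
  by rewrite -sumrN; apply: eq_bigr => j _; rewrite mulNr mulr_suml.
rewrite exchange_big; congr (- _); apply: eq_bigr => i _ /=.
by rewrite hC mulr_sumr; apply: eq_bigr => j _; rewrite mulrA.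
Qed.

Variables (r0 A B : R).
Hypothesis r0_gt0 : 0 < r0.
Hypotheses (a0 : forall i, a i mi_zero = 0) (a_nrm : forall i, nrm r0 (a i) A).
Hypothesis C_nrm : forall i j, nrm r0 (Cm i j) B.

Lemma field_coef_nrm k j r : 0 < r -> r <= r0 ->
  nrm r (field_coef k j) ((n%:R * B) ^+ k * (A / r0) * r).
Proof.
move=> hr rr; elim: k j => [|k IH] j /=.
  (* Vanishing at the origin converts the smaller radius into the factor [r]. *)
  rewrite expr0 mul1r; have -> : A / r0 * r = r / r0 * A by ring.
  have {1}-> : r = r / r0 * r0 by rewrite divfK// gt_eqF.
  have l0 : 0 <= r / r0 by rewrite divr_ge0// ltW.
  have l1 : r / r0 <= 1 by rewrite ler_pdivrMr// mul1r.
  exact: nrm_shrink (a0 j) (ltW r0_gt0) l0 l1 (a_nrm j).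
apply: nrmN; apply: (@nrm_le _ _ _ _
    (\sum_(i < n) (n%:R * B) ^+ k * (A / r0) * r * B)).
  by rewrite sumr_const card_ord -mulr_natl exprS le_eqVlt; apply/orP; left; apply/eqP; ring.
apply: nrm_sum => [|i _]; first exact: ltW.
apply: nrmM => //; first exact: ltW.
by apply: nrm_mono (C_nrm i j) => //; exact: ltW.
Qed.

Lemma field_op_nrm k q r r' N : 0 < r -> r < r' -> r' <= r0 -> nrm r' q N ->
  nrm r (field_op k q) (n%:R * (A / r0) * (n%:R * B) ^+ k * (r / (r' - r)) * N).
Proof.
move=> hr rr rr0 hq; apply: (@nrm_le _ _ _ _
    (\sum_(i < n) (n%:R * B) ^+ k * (A / r0) * r * (N / (r' - r)))).
  by rewrite sumr_const card_ord -mulr_natl le_eqVlt; apply/orP; left; apply/eqP; ring.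
apply: nrm_sum => [|i _]; first exact: ltW.
apply: nrmM; [exact: ltW|apply: field_coef_nrm => //; lra|].
by apply: nrm_pderiv hq => //; exact: ltW.
Qed.
End VectorField.

(* Moser's path method: [g + t h] is constant along the flow of the vector field
   [- a (1 + t Cm)^-1 d], which vanishes at the origin and depends analytically on [t]. *)
Lemma right_equiv_deform (g h : ps) (a : 'I_n -> ps) (Cm : 'I_n -> 'I_n -> ps) :
  g \in conv -> (forall i, a i \in conv) -> (forall i j, Cm i j \in conv) ->
  (forall i, a i mi_zero = 0) ->
  h = \sum_i a i * pderiv i g ->
  (forall i, pderiv i h = \sum_j Cm i j * pderiv j g) ->
  exists2 e : R, 0 < e & forall s : C, cmod s <= e -> right_equiv g (g + pC s * h).
Proof.
move=> hg ha hC a0 hE dhE.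
have [r1 [A [r1_gt0 A0 hA]]] := conv_family ha.
have [r2 [B [r2_gt0 B0 hB]]] := conv_family (fun ij : 'I_n * 'I_n => hC ij.1 ij.2).
pose r0 := Num.min r1 r2.
have r0_gt0 : 0 < r0 by rewrite lt_min r1_gt0.
have hA0 i : nrm r0 (a i) A by apply: nrm_mono (hA i); rewrite ?ge_min ?lexx// ltW.
have hB0 i j : nrm r0 (Cm i j) B.
  by apply: nrm_mono (hB (i, j)); rewrite ?ge_min ?lexx ?orbT// ltW.
(* [K] and [c] are the constants of [field_op_nrm]; [M] meets the two requirements of
   [geom_convolution_le], and the summand 1 keeps it positive. *)
pose K := n%:R * (A / r0); pose c := n%:R * B; pose M := 2 * c + 32 * K + 1.
have K0 : 0 <= K by rewrite mulr_ge0// divr_ge0// ltW.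
have c0 : 0 <= c by rewrite mulr_ge0.
have M0 : 0 < M by rewrite /M; lra.
have cM : 2 * c <= M by rewrite /M; lra.
have KM : 32 * K <= M by rewrite /M; lra.
(* The flow is tame with constant 2 M, and the parameter times this constant must be at most 1/4. *)
exists (8 * M)^-1; first by rewrite invr_gt0 mulr_gt0.
move=> s hs; exists (series_op s (flow (field_op a Cm))).
have hsM : cmod s * (2 * M) <= 4^-1.
  apply: le_trans (ler_wpM2r _ hs) _; first by rewrite mulr_ge0// ltW.
  by rewrite invfM -mulrA [M^-1 * _]mulrCA mulVf ?gt_eqF//; lra.
have XD := field_opD a Cm; have XZ := field_opZ a Cm; have XM := field_opM a Cm.
have XG := @field_op_gsum a Cm.
have XN := field_op_nrm r0_gt0 a0 hA0 hB0.
split; first exact: (flow_automorphism XD XZ XM XG K0 c0 M0 cM KM XN r0_gt0 hsM).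
have tF := tame_flow XD XZ XG K0 c0 M0 cM KM XN.
have M2 : 0 <= 2 * M by rewrite mulr_ge0// ltW.
have flow1g : flow (field_op a Cm) 1 g = h.
  by rewrite flowS// big_ord_recr big_ord0/= add0r invr1 pC1 mul1r flow0 /field_op hE.
apply: (series_op_fix r0_gt0 hsM M2 tF hg _ flow1g) => // k.
(* In the recursion for order k + 2 the first two summands are X_(k+1) g and X_k h, which cancel;
   the others contain earlier vanishing terms. *)
elim/ltn_ind: k => k IH; rewrite flowS// big_ord_recl big_ord_recl/= flow0 flow1g.
rewrite /bump leqn0 subn0 addn0 subSS subn0 (@field_opS a Cm g h k dhE).
rewrite addrA addNr add0r big1 ?mulr0// => i _.
rewrite !add1n IH ?(field0 XZ)//.
Qed.
End FlowEquivalence.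

(** * Automorphisms and ideals *)

Section Automorphisms.
Variables (R : realType) (n : nat).
Local Notation C := (R[i]).
Local Notation ps := (ps R n).
Local Notation mono := (@mono R n).
Local Notation px i := (mono (mi_unit i)).
Implicit Types (p q f g : ps) (phi psi : ps -> ps).

Lemma convergentE f : convergent f <-> f \in conv.
Proof. by split=> [h|/asboolP//]; apply/asboolP. Qed.

Section AutTheory.
Variable phi : ps -> ps.
Hypothesis aut_phi : is_automorphism phi.

Lemma aut_conv f : f \in conv -> phi f \in conv.
Proof. by case: aut_phi => h _ /convergentE hf; apply/convergentE/h. Qed.
Lemma autD f g : f \in conv -> g \in conv -> phi (f + g) = phi f + phi g.
Proof. by case: aut_phi => _ [h _] /convergentE hf /convergentE hg; exact: h. Qed.
Lemma autM f g : f \in conv -> g \in conv -> phi (f * g) = phi f * phi g.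
Proof. by case: aut_phi => _ [_ [h _]] /convergentE hf /convergentE hg; exact: h. Qed.
Lemma autZ (c : C) f : f \in conv -> phi (pC c * f) = pC c * phi f.
Proof.
by case: aut_phi => _ [_ [_ [h _]]] /convergentE hf; rewrite -!pscaleE; exact: h.
Qed.
Lemma aut1 : phi 1 = 1. Proof. by case: aut_phi => _ [_ [_ [_ [h _]]]]. Qed.
Lemma aut_inj f g : f \in conv -> g \in conv -> phi f = phi g -> f = g.
Proof.
case: aut_phi => _ [_ [_ [_ [_ [h _]]]]] /convergentE hf /convergentE hg; exact: h.
Qed.
Lemma aut_surj g : g \in conv -> exists2 f, f \in conv & phi f = g.
Proof.
case: aut_phi => _ [_ [_ [_ [_ [_ h]]]]] /convergentE /h[f [/convergentE hf <-]].
by exists f.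
Qed.
Lemma autC (c : C) : phi (pC c) = pC c.
Proof. by have := autZ c (rpred1 conv); rewrite !mulr1 aut1 mulr1. Qed.
Lemma aut0 : phi 0 = 0. Proof. by have := autC 0; rewrite pC0. Qed.
Lemma autB f g : f \in conv -> g \in conv -> phi (f - g) = phi f - phi g.
Proof.
move=> hf hg; rewrite autD ?rpredN//; congr (_ + _).
by have := autZ (-1) hg; rewrite pCN pC1 !mulN1r.
Qed.
Lemma aut_sum (I : eqType) (s : seq I) (F : I -> ps) :
  (forall i, F i \in conv) -> phi (\sum_(i <- s) F i) = \sum_(i <- s) phi (F i).
Proof.
move=> hF; elim: s => [|i s IH]; first by rewrite !big_nil aut0.
by rewrite !big_cons autD ?rpred_sum// IH.
Qed.

(** If [phi f] had constant term c != 0, then f - c would be a unit while its image has no constant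
    term. *)
Lemma aut_local f : f \in conv -> f mi_zero = 0 -> phi f mi_zero = 0.
Proof.
move=> hf f0; apply/eqP/negPn/negP => c0; set c := phi f mi_zero in c0.
have hfc : f - pC c \in conv by rewrite rpredB ?conv_pC.
have [|v hv hfv] := conv_unit hfc; first by rewrite pcoefB f0 pcoefC eqxx mulr1 sub0r oppr_eq0.
have := congr1 (fun g : ps => g mi_zero) (congr1 phi hfv).
rewrite autM// autB ?conv_pC// aut1 autC pcoefM0 pcoefB pcoefC eqxx mulr1 subrr mul0r.
by rewrite pcoef1 eqxx => /esym/eqP; rewrite oner_eq0.
Qed.

Lemma aut_inverse : exists2 psi, is_automorphism psi &
  forall q, q \in conv -> psi (phi q) = q /\ phi (psi q) = q.
Proof.
(* Choice is made for every series, with witness 0 off the convergent ones, where nothing is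
   claimed. *)
have sur g : exists f, g \in conv -> f \in conv /\ phi f = g.
  case: (boolP (g \in conv)) => [/aut_surj[f hf fE]|]; first by exists f.
  by exists 0.
pose psi g := projT1 (cid (sur g)).
have psiP g : g \in conv -> psi g \in conv /\ phi (psi g) = g.
  exact: (projT2 (cid (sur g))).
have psiK f : f \in conv -> psi (phi f) = f.
  move=> hf; have [h1 h2] := psiP _ (aut_conv hf); exact: aut_inj.
have psi_eq f g : f \in conv -> phi f = g -> psi g = f by move=> hf <-; exact: psiK.
exists psi; last by move=> q hq; split; [exact: psiK | exact: (psiP q hq).2].
split; [|split; [|split; [|split; [|split; [|split]]]]].
- by move=> f /convergentE /psiP[h _]; exact/convergentE.
- move=> f g /convergentE /psiP[hf fE] /convergentE /psiP[hg gE].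
  apply: psi_eq; first exact: rpredD.
  by rewrite autD// fE gE.
- move=> f g /convergentE /psiP[hf fE] /convergentE /psiP[hg gE].
  apply: psi_eq; first exact: rpredM.
  by rewrite autM// fE gE.
- move=> c f /convergentE /psiP[hf fE]; rewrite !pscaleE.
  by apply: psi_eq; [rewrite rpredM ?conv_pC | rewrite autZ// fE].
- by apply: psi_eq; [exact: rpred1 | exact: aut1].
- by move=> f g /convergentE /psiP[_ fE] /convergentE /psiP[_ gE] h; rewrite -fE h gE.
- by move=> g /convergentE hg; exists (phi g); split; [apply/convergentE/aut_conv | exact: psiK].
Qed.
End AutTheory.

Lemma aut_comp phi psi :
  is_automorphism phi -> is_automorphism psi -> is_automorphism (fun q => psi (phi q)).
Proof.
move=> hphi hpsi; have C1 := aut_conv hphi; have C2 := aut_conv hpsi.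
split; [|split; [|split; [|split; [|split; [|split]]]]].
- by move=> f /convergentE hf; apply/convergentE; auto.
- move=> f g /convergentE hf /convergentE hg.
  by rewrite (autD hphi)// (autD hpsi)// C1.
- move=> f g /convergentE hf /convergentE hg.
  by rewrite (autM hphi)// (autM hpsi)// C1.
- by move=> c f /convergentE hf; rewrite !pscaleE (autZ hphi)// (autZ hpsi)// C1.
- by rewrite (aut1 hphi) (aut1 hpsi).
- move=> f g /convergentE hf /convergentE hg /(aut_inj hpsi (C1 _ hf) (C1 _ hg)).
  exact: (aut_inj hphi hf hg).
- move=> g /convergentE /(aut_surj hpsi)[f hf <-].
  by have [e he <-] := aut_surj hphi hf; exists e; split=> //; exact/convergentE.
Qed.

Lemma right_equiv_refl f : right_equiv f f.
Proof.
exists id; split=> //; do ![split=> //] => g hg.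
by exists g.
Qed.
Lemma right_equiv_sym f g : f \in conv -> right_equiv f g -> right_equiv g f.
Proof.
move=> hf [phi [hphi <-]]; have [psi hpsi psiK] := aut_inverse hphi.
by exists psi; split=> //; case: (psiK f hf).
Qed.
Lemma right_equiv_trans f g h : right_equiv f g -> right_equiv g h -> right_equiv f h.
Proof.
move=> [phi [hphi <-]] [psi [hpsi <-]]; exists (fun q => psi (phi q)); split=> //.
exact: aut_comp.
Qed.

(** Each monomial of [q] is assigned by [pick] to one admissible generator. The cofactors are
    shifted selections of the coefficients of [q], hence converge. [P] carries extra information on
    the assigned exponents, such as being different from the generator. *)
Lemma split_monomials k (b : 'I_k -> mi n) (P : 'I_k -> pred (mi n)) q :
  q \in conv -> (forall a, q a != 0 -> exists2 j, mi_le (b j) a & P j a) ->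
  exists h : 'I_k -> ps, [/\ forall j, h j \in conv,
    forall j c, h j c != 0 -> P j (mi_add (b j) c) & q = \sum_j mono (b j) * h j].
Proof.
move=> hq hP; pose J a := [pick j | mi_le (b j) a && P j a].
pose h j : ps := fun c => if J (mi_add (b j) c) == Some j then q (mi_add (b j) c) else 0.
exists h; split.
- move=> j; have /asboolP/convergent_sup[r [M [r0 hM]]] := hq.
  apply/asboolP/convergent_sup; exists r, (M / r ^+ mdegree (b j)); split=> // c.
  have rj : 0 < r ^+ mdegree (b j) by rewrite exprn_gt0.
  have M0 : 0 <= M.
    by apply: le_trans (hM mi_zero); rewrite mulr_ge0 ?cmod_ge0// exprn_ge0// ltW.
  rewrite /h; case: ifP => _; last by rewrite cmod0 mul0r divr_ge0// ltW.
  rewrite ler_pdivlMr// -mulrA -exprD addnC -mdegD; exact: hM.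
- move=> j c; rewrite /h; case: ifP => [|_]; last by rewrite eqxx.
  by rewrite /J; case: pickP => // i /andP[_ hi] /eqP[ij]; rewrite ij in hi.
apply: psP => a; rewrite pcoef_sum.
have -> : \sum_j (mono (b j) * h j) a = \sum_j (if J a == Some j then q a else 0).
  apply: eq_bigr => j _; rewrite pcoef_monoM /h; case: ifP => [hj|hj].
    by rewrite mi_addC mi_subK.
  case: ifP => // /eqP; rewrite /J; case: pickP => // i /andP[hi _] [ij].
  by rewrite ij hj in hi.
case: (eqVneq (q a) 0) => [->|qa]; first by rewrite big1// => j _; case: ifP.
rewrite /J; case: pickP => [i _|hn].
  rewrite (bigD1 i)//= eqxx big1 ?addr0// => j ji.
  by case: eqP => // -[ij]; rewrite ij eqxx in ji.
by have [j h1 h2] := hP a qa; have := hn j; rewrite h1 h2.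
Qed.

Lemma hadamard q : q \in conv -> exists h : 'I_n -> ps,
  (forall i, h i \in conv) /\ q = pC (q mi_zero) + \sum_i px i * h i.
Proof.
move=> hq; set c := q mi_zero.
have [||h [hc _ hE]] := @split_monomials n (fun i => mi_unit i) (fun _ => predT) (q - pC c).
- by rewrite rpredB ?conv_pC.
- move=> a; case: (eqVneq a mi_zero) => [->|/mi_neq0P[i hi] _].
    by rewrite pcoefB pcoefC eqxx mulr1 subrr eqxx.
  by exists i; rewrite ?mi_leU.
by exists h; split=> //; rewrite -hE addrC subrK.
Qed.

Lemma pderivC i (c : C) : pderiv i (pC c : ps) = 0.
Proof.
apply: psP => a; rewrite /pderiv pcoefC.
case: eqP => [/(congr1 (fun b : mi n => b i))|]; last by rewrite !mulr0.
by rewrite !miE eqxx addn1.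
Qed.
Lemma pderivX i j : pderiv i (px j) = (i == j)%:R.
Proof.
rewrite pderiv_mono !miE; case: eqP => [->|_]; last by rewrite pC0 mul0r.
have -> : mi_sub (mi_unit j) (mi_unit j) = mi_zero by apply/ffunP => l; rewrite !miE subnn.
by rewrite pC1 mul1r.
Qed.

Lemma ordge_sum (I : Type) (s : seq I) (F : I -> ps) k :
  (forall i, ordge k (F i)) -> ordge k (\sum_(i <- s) F i).
Proof. by move=> h a ha; rewrite pcoef_sum big1// => i _; rewrite h. Qed.

(* The defect of the chain rule is a derivation along [phi] which kills the
   coordinates, hence has arbitrarily large order. *)
Lemma chain_rule phi i q : is_automorphism phi -> q \in conv ->
  pderiv i (phi q) = \sum_j phi (pderiv j q) * pderiv i (phi (px j)).
Proof.
move=> hphi hq.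
pose D (p : ps) := pderiv i (phi p) - \sum_j phi (pderiv j p) * pderiv i (phi (px j)).
have DD p p' : p \in conv -> p' \in conv -> D (p + p') = D p + D p'.
  move=> hp hp'; rewrite /D autD// pderivD.
  under eq_bigr => j _ do rewrite pderivD (autD hphi) ?conv_pderiv// mulrDl.
  rewrite big_split/=; ring.
have DX l : D (px l) = 0.
  rewrite /D (bigD1 l)//= pderivX eqxx (aut1 hphi) mul1r big1 ?addr0 ?subrr// => j /negPf h.
  by rewrite pderivX h (aut0 hphi) mul0r.
have DC c : D (pC c) = 0.
  rewrite /D (autC hphi) pderivC big1 ?subrr// => j _.
  by rewrite pderivC (aut0 hphi) mul0r.
have DM p p' : p \in conv -> p' \in conv -> D (p * p') = D p * phi p' + phi p * D p'.
  move=> hp hp'; rewrite /D autM// pderivM.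
  have -> : \sum_j phi (pderiv j (p * p')) * pderiv i (phi (px j)) =
     (\sum_j phi (pderiv j p) * pderiv i (phi (px j))) * phi p' +
     phi p * (\sum_j phi (pderiv j p') * pderiv i (phi (px j))).
    rewrite mulr_suml mulr_sumr -big_split; apply: eq_bigr => j _ /=.
    by rewrite pderivM (autD hphi) ?rpredM ?conv_pderiv// !(autM hphi) ?conv_pderiv//; ring.
  by ring.
suff hD k p : p \in conv -> ordge k (D p).
  apply/eqP; rewrite -subr_eq0; apply/eqP; apply: psP => a.
  exact: (hD (mdegree a).+1 q hq).
elim: k p => [p _ a|k IH p hp]; first by rewrite ltn0.
have [h [hc hE]] := hadamard hp.
have Dsum : D (\sum_l px l * h l) = \sum_l D (px l * h l).
  apply: (big_rec2 (fun x y => x \in conv /\ D x = y)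
    (r := index_enum _) (P := predT) (F1 := fun l => px l * h l)
    (F2 := fun l => D (px l * h l)) _ _).2; last first.
    move=> l x y _ [hx <-]; split; first by rewrite rpredD ?rpredM ?conv_mono.
    by rewrite DD ?rpredM ?conv_mono.
  split; first exact: rpred0.
  by have := DC 0; rewrite pC0.
rewrite hE DD ?conv_pC//; last by apply: rpred_sum => l _; rewrite rpredM ?conv_mono.
rewrite DC add0r Dsum; apply: ordge_sum => l.
rewrite DM ?conv_mono// DX mul0r add0r -add1n; apply: ordgeM; last exact: IH.
move=> a; rewrite ltnS leqn0 => /eqP/mdeg_eq0 ->.
apply: aut_local => //; first exact: conv_mono.
rewrite /Defs.mono; case: eqP => // /(congr1 (fun b : mi n => b l)).
by rewrite !miE eqxx.
Qed.

Section Ideals.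
Implicit Types (S T : ps -> Prop).

Lemma ideal_genE S p : ideal_gen S p <->
  exists k (h g : 'I_k -> ps), (forall j, h j \in conv /\ S (g j)) /\ p = \sum_j h j * g j.
Proof.
split=> -[k [h [g [H ->]]]]; exists k, h, g; (split; last by rewrite psumE).
  by move=> j; have [/convergentE] := H j.
by move=> j; have [/convergentE] := H j.
Qed.

Lemma ideal_gen0 S : ideal_gen S 0.
Proof.
apply/ideal_genE; exists 0%N, (fun=> 0), (fun=> 0); split; first by case.
by rewrite big_ord0.
Qed.
Lemma ideal_gen_incl S g : S g -> ideal_gen S g.
Proof.
move=> hg; apply/ideal_genE; exists 1%N, (fun=> 1), (fun=> g).
by split=> [j|]; [split=> //; exact: rpred1 | rewrite big_ord1 mul1r].
Qed.
Lemma ideal_genM S c p : c \in conv -> ideal_gen S p -> ideal_gen S (c * p).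
Proof.
move=> hc /ideal_genE[k [h [g [H ->]]]]; apply/ideal_genE.
exists k, (fun j => c * h j), g; split.
  by move=> j; have [h1 h2] := H j; rewrite rpredM.
by rewrite mulr_sumr; apply: eq_bigr => j _; rewrite mulrA.
Qed.
Lemma ideal_genD S p q : ideal_gen S p -> ideal_gen S q -> ideal_gen S (p + q).
Proof.
move=> /ideal_genE[k [h [g [H ->]]]] /ideal_genE[k' [h' [g' [H' ->]]]]; apply/ideal_genE.
exists (k + k')%N, (fun j => match split j with inl i => h i | inr i => h' i end),
  (fun j => match split j with inl i => g i | inr i => g' i end); split.
  by move=> j; case: split.
rewrite big_split_ord/=; congr (_ + _); apply: eq_bigr => i _.
  by have -> : split (lshift k' i) = inl i by exact: (unsplitK (inl i)).
by have -> : split (rshift k i) = inr i by exact: (unsplitK (inr i)).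
Qed.
Lemma ideal_gen_sum S (I : Type) (s : seq I) (F : I -> ps) :
  (forall i, ideal_gen S (F i)) -> ideal_gen S (\sum_(i <- s) F i).
Proof.
move=> h; apply: big_ind => //; [exact: ideal_gen0|exact: ideal_genD].
Qed.
Lemma ideal_gen_min S T p : (forall g, S g -> ideal_gen T g) -> ideal_gen S p -> ideal_gen T p.
Proof.
move=> ST /ideal_genE[k [h [g [H ->]]]]; apply: ideal_gen_sum => j.
by have [h1 h2] := H j; apply: ideal_genM => //; exact: ST.
Qed.
Lemma ideal_gen_conv S p : (forall g, S g -> g \in conv) -> ideal_gen S p -> p \in conv.
Proof.
move=> hS /ideal_genE[k [h [g [H ->]]]]; apply: rpred_sum => j _.
by have [h1 h2] := H j; rewrite rpredM// hS.
Qed.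

Lemma ext_jacobian_conv f p : f \in conv -> ext_jacobian_ideal f p -> p \in conv.
Proof.
by move=> hf; apply: ideal_gen_conv => g [->//|[i ->]]; exact: conv_pderiv.
Qed.

(** The chain rule is applied to f = psi (phi f) rather than to phi f: this writes the derivatives
    of [f] through those of [phi f], which is the inclusion wanted. *)
Lemma aut_ext_jacobian phi f q : is_automorphism phi -> f \in conv ->
  ext_jacobian_ideal f q -> ext_jacobian_ideal (phi f) (phi q).
Proof.
move=> hphi hf /ideal_genE[k [h [g [H ->]]]].
have gc j : g j \in conv by have [_ [->//|[i ->]]] := H j; exact: conv_pderiv.
have hc j : h j \in conv by have [] := H j.
rewrite (aut_sum hphi) => [|j]; last by rewrite rpredM.
apply: ideal_gen_sum => j; rewrite (autM hphi)//; apply: ideal_genM; first exact: aut_conv.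
have [_ [->|[i ->]]] := H j; first by apply: ideal_gen_incl; left.
have [psi hpsi psiK] := aut_inverse hphi.
have hpf := aut_conv hphi hf.
have c1 l : psi (pderiv l (phi f)) \in conv by rewrite (aut_conv hpsi) ?conv_pderiv.
have c2 l : pderiv i (psi (px l)) \in conv by rewrite conv_pderiv ?(aut_conv hpsi) ?conv_mono.
have -> : pderiv i f = pderiv i (psi (phi f)) by rewrite (psiK f hf).1.
rewrite (chain_rule i hpsi)// (aut_sum hphi) => [|l]; last by rewrite rpredM.
apply: ideal_gen_sum => l; rewrite (autM hphi)// mulrC; apply: ideal_genM.
  exact: aut_conv.
rewrite (psiK _ (conv_pderiv l hpf)).2; apply: ideal_gen_incl; right; by exists l.
Qed.

Lemma ext_jacobian_aut phi f x : is_automorphism phi -> f \in conv ->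
  ext_jacobian_ideal (phi f) x <-> exists q, ext_jacobian_ideal f q /\ x = phi q.
Proof.
move=> hphi hf; split=> [hx|[q [hq ->]]]; last exact: aut_ext_jacobian.
have [psi hpsi psiK] := aut_inverse hphi.
have hpf := aut_conv hphi hf.
exists (psi x); split; last by rewrite (psiK x (ext_jacobian_conv hpf hx)).2.
by have := aut_ext_jacobian hpsi hpf hx; rewrite (psiK f hf).1.
Qed.

End Ideals.
End Automorphisms.

(** * Monomial ideals and their Jacobian matrices *)

Section ConstantCoefficient.
Variables (R : realType) (n : nat).
Local Notation C := (R[i]).
Local Notation ps := (ps R n).

Definition cst_coef (f : ps) : C := f mi_zero.
Fact cst_coef_zmod : zmod_morphism cst_coef. Proof. by []. Qed.
Fact cst_coef_monoid : monoid_morphism cst_coef.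
Proof. by split; [rewrite /cst_coef pcoef1 eqxx | exact: pcoefM0]. Qed.
HB.instance Definition _ := GRing.isZmodMorphism.Build ps C cst_coef cst_coef_zmod.
HB.instance Definition _ := GRing.isMonoidMorphism.Build ps C cst_coef cst_coef_monoid.

Lemma det_conv k (T : 'M[ps]_k) : (forall i j, T i j \in conv) -> \det T \in conv.
Proof.
move=> hT; apply: rpred_sum => s _; rewrite rpredM ?rpred_sign//.
by apply: rpred_prod.
Qed.
Lemma adj_conv k (T : 'M[ps]_k) : (forall i j, T i j \in conv) ->
  forall i j, (\adj T) i j \in conv.
Proof.
move=> hT i j; rewrite mxE /cofactor rpredM ?rpred_sign// det_conv// => i' j'.
by rewrite !mxE.
Qed.
Lemma mulmx_conv a b c (S : 'M[ps]_(a, b)) (T : 'M[ps]_(b, c)) :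
  (forall i j, S i j \in conv) -> (forall i j, T i j \in conv) ->
  forall i j, (S *m T) i j \in conv.
Proof. by move=> hS hT i j; rewrite mxE; apply: rpred_sum => l _; rewrite rpredM. Qed.

(** A determinant with constant term 1 is a unit, so the adjugate yields an inverse. This is the
    form in which Nakayama's lemma is used. *)
Lemma conv_invmx k (T : 'M[ps]_k) : (forall i j, T i j \in conv) ->
  map_mx cst_coef T = 1%:M ->
  exists2 T' : 'M[ps]_k, forall i j, T' i j \in conv & T' *m T = 1%:M.
Proof.
move=> hT T0; have hd := det_conv hT.
have [|v hv hvE] := conv_unit hd.
  rewrite -[_ mi_zero]/(cst_coef _) -det_map_mx T0 det1; exact: oner_neq0.
exists (v *: \adj T); first by move=> i j; rewrite mxE rpredM ?adj_conv.
by rewrite -scalemxAl mul_adj_mx -mul_scalar_mx -scalar_mxM mulrC hvE.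
Qed.
End ConstantCoefficient.

Section MonomialIdeal.
Variables (R : realType) (n : nat).
Local Notation C := (R[i]).
Local Notation ps := (ps R n).
Local Notation mono := (@mono R n).
Variables (k : nat) (b : 'I_k -> mi n).
Implicit Types (p q f g h x : ps).

Definition mideal x := ideal_gen (fun m => exists j, m = mono (b j)) x.

Lemma mideal_coef x a : mideal x -> x a != 0 -> exists j, mi_le (b j) a.
Proof.
move=> /ideal_genE[m [h [g [H ->]]]] xa; apply: contrapT => hn; case/eqP: xa.
rewrite pcoef_sum big1// => j _; have [_ [l ->]] := H j.
by rewrite mulrC pcoef_monoM; case: ifP => // hl; case: hn; exists l.
Qed.

Lemma mideal_split x : x \in conv -> (forall a, x a != 0 -> exists j, mi_le (b j) a) ->
  exists h : 'I_k -> ps, (forall j, h j \in conv) /\ x = \sum_j mono (b j) * h j.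
Proof.
move=> hx hb; have [|h [h1 _ h2]] := @split_monomials R n k b (fun _ => predT) x hx.
  by move=> a /hb[j hj]; exists j.
by exists h.
Qed.

Lemma mideal_mono (h : 'I_k -> ps) : (forall j, h j \in conv) -> mideal (\sum_j mono (b j) * h j).
Proof.
move=> hh; apply: ideal_gen_sum => j; rewrite mulrC; apply: ideal_genM => //.
by apply: ideal_gen_incl; exists j.
Qed.


(* Membership in the primitive ideal of [mideal]: by [primitive_pderiv], the series and all
   its partial derivatives lie in [mideal]. *)
Definition primitive h := [/\ h \in conv, h mi_zero = 0 &
  forall a i, h a != 0 -> (0 < a i)%N -> exists j, mi_le (b j) (mi_sub a (mi_unit i))].

Lemma primitive_pderiv h : h \in conv -> h mi_zero = 0 ->
  (forall i, mideal (pderiv i h)) <-> primitive h.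
Proof.
move=> hc h0; split=> [hd|[_ _ hb] i].
  split=> // a i ha ai; apply: (mideal_coef (hd i)).
  rewrite /pderiv mi_subK ?mi_leU// mulf_neq0// pnatr_eq0//.
have [|H [Hc HE]] := mideal_split (conv_pderiv i hc); last by rewrite HE; exact: mideal_mono.
move=> a; rewrite /pderiv mulf_eq0 negb_or => /andP[_ ha].
by have [|j] := hb _ i ha; [rewrite !miE eqxx addn1 | rewrite mi_addK; exists j].
Qed.

Lemma primitiveD h h' : primitive h -> primitive h' -> primitive (h + h').
Proof.
move=> [c1 z1 p1] [c2 z2 p2]; split; [by rewrite rpredD|by rewrite pcoefD z1 z2 addr0|].
move=> a i; rewrite pcoefD => ha ai.
case: (eqVneq (h a) 0) => [h0|]; last by move/p1; exact.
by apply: p2 ai; move: ha; rewrite h0 add0r.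
Qed.
Lemma primitiveZ (c : C) h : primitive h -> primitive (pC c * h).
Proof.
move=> [c1 z1 p1]; split; [by rewrite rpredM ?conv_pC|by rewrite pcoefCM z1 mulr0|].
by move=> a i; rewrite pcoefCM mulf_eq0 negb_or => /andP[_]; exact: p1.
Qed.

(** A generator dividing a lowered exponent of [h] divides the exponent properly, so every cofactor
    lies in the maximal ideal m: [h] is in m I. *)
Lemma primitive_split h : primitive h -> exists m : 'I_k -> ps,
  [/\ forall j, m j \in conv, forall j, m j mi_zero = 0 & h = \sum_j mono (b j) * m j].
Proof.
move=> [hc h0 hp].
have [|m [m1 m2 m3]] := @split_monomials R n k b (fun j a => b j != a) h hc.
  move=> a ha; case: (eqVneq a mi_zero) => [a0|/mi_neq0P[i ai]].
    by rewrite a0 h0 eqxx in ha.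
  have [j hj] := hp a i ha ai; exists j; first exact: mi_le_trans hj (mi_le_sub _ _).
  apply/eqP => /(congr1 (fun c : mi n => c i)); move/mi_leP: hj => /(_ i).
  by rewrite !miE eqxx; lia.
exists m; split=> // j; apply/eqP/negPn/negP => /m2; rewrite mi_addC mi_add0.
by rewrite eqxx.
Qed.

Hypothesis b_anti : forall i j, mi_le (b i) (b j) -> i = j.

(** In an antichain only the constant term of the [l]-th factor reaches the exponent [b l]: the
    coefficients at the generators are coordinates on I / m I. *)
Lemma coef_at_generator (G : 'I_k -> ps) l :
  (\sum_j mono (b j) * G j) (b l) = G l mi_zero.
Proof.
rewrite pcoef_sum (bigD1 l)//= big1 ?addr0.
  have := pcoef_monoMD (b l) (G l) mi_zero.
  by rewrite mi_addC mi_add0.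
by move=> j jl; rewrite pcoef_monoM; case: ifP => // /b_anti jE; rewrite jE eqxx in jl.
Qed.

Lemma coef_at_generatorM q (G : 'I_k -> ps) l :
  (q * \sum_j mono (b j) * G j) (b l) = q mi_zero * G l mi_zero.
Proof.
rewrite mulr_sumr -pcoefM0 -(coef_at_generator (fun j => q * G j)) !pcoef_sum.
by apply: eq_bigr => j _; rewrite mulrCA.
Qed.

Definition jac_mx g : 'M[C]_(n, k) := \matrix_(i, j) (pderiv i g) (b j).

Lemma jac_mxD g h : jac_mx (g + h) = jac_mx g + jac_mx h.
Proof. by apply/matrixP => i j; rewrite !mxE pderivD. Qed.
Lemma jac_mxZ (c : C) g : jac_mx (pC c * g) = c *: jac_mx g.
Proof. by apply/matrixP => i j; rewrite !mxE pderivCM pcoefCM. Qed.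

Lemma primitive_deriv_split h : primitive h -> exists H : 'I_n -> 'I_k -> ps,
  (forall i j, H i j \in conv) /\ forall i, pderiv i h = \sum_j mono (b j) * H i j.
Proof.
move=> hp; have [hc h0 _] := hp.
have e i : exists H : 'I_k -> ps, (forall j, H j \in conv) /\ pderiv i h = \sum_j mono (b j) * H j.
  apply: mideal_split; first exact: conv_pderiv.
  by move=> a; apply: mideal_coef; exact: ((primitive_pderiv hc h0).2 hp i).
exists (fun i => projT1 (cid (e i))); split=> i.
  by have [h1 _] := projT2 (cid (e i)).
by have [_ h2] := projT2 (cid (e i)).
Qed.

(** The derivatives are G times the vector of generators, and D G is the identity modulo the maximal
    ideal; inverting D G over the convergent series solves for the generators. *)
Lemma generators_from_jacobian g D : primitive g -> D *m jac_mx g = 1%:M ->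
  exists H : 'I_k -> 'I_n -> ps, (forall j i, H j i \in conv) /\
    forall j, mono (b j) = \sum_i H j i * pderiv i g.
Proof.
move=> /primitive_deriv_split[G [Gc GE]] hD.
pose Gm : 'M[ps]_(n, k) := \matrix_(i, j) G i j.
pose Dm : 'M[ps]_(k, n) := map_mx (@pC R n) D.
have Gmc i j : Gm i j \in conv by rewrite mxE.
have Dmc i j : Dm i j \in conv by rewrite mxE conv_pC.
have G0 : map_mx (@cst_coef R n) Gm = jac_mx g.
  by apply/matrixP => i j; rewrite !mxE GE coef_at_generator.
have D0 : map_mx (@cst_coef R n) Dm = D.
  by apply/matrixP => i j; rewrite !mxE /cst_coef pcoefC eqxx mulr1.
have [|T Tc TE] := @conv_invmx R n k (Dm *m Gm) (mulmx_conv Dmc Gmc).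
  by rewrite map_mxM D0 G0.
exists (fun j i => (T *m Dm) j i); split=> [j i|j]; first exact: mulmx_conv.
pose B : 'cV[ps]_k := \col_j mono (b j).
pose dg : 'cV[ps]_n := \col_i pderiv i g.
have dgE : dg = Gm *m B.
  by apply/matrixP => i l; rewrite !mxE GE; apply: eq_bigr => j' _; rewrite !mxE mulrC.
have BE : B = (T *m Dm) *m dg by rewrite dgE mulmxA -[T *m Dm *m Gm]mulmxA TE mul1mx.
have := congr1 (fun A : 'cV[ps]_k => A j 0) BE; rewrite [LHS]mxE => ->.
by rewrite mxE; apply: eq_bigr => i _; rewrite [dg _ _]mxE.
Qed.

Lemma ext_jacobian_combination f x : ext_jacobian_ideal f x ->
  exists (H : 'I_n -> ps) h0, x = \sum_i H i * pderiv i f + h0 * f.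
Proof.
move=> /ideal_genE[m [h [g [H ->]]]].
elim/big_ind: _ => [|p q [H1 [h1 ->]] [H2 [h2 ->]]|j _].
- by exists (fun=> 0), 0; rewrite mul0r addr0 big1// => i _; rewrite mul0r.
- exists (fun i => H1 i + H2 i), (h1 + h2).
  under [in RHS]eq_bigr do rewrite mulrDl.
  by rewrite big_split/= mulrDl; ring.
have [_ [->|[i ->]]] := H j.
  by exists (fun=> 0), (h j); rewrite big1 ?add0r// => i _; rewrite mul0r.
exists (fun l => if l == i then h j else 0), 0; rewrite mul0r addr0 (bigD1 i)//= eqxx.
by rewrite big1 ?addr0// => l /negPf ->; rewrite mul0r.
Qed.

(** Write each generator through the derivatives of [f] and [f], and compare coefficients at the
    generators. As [f] is in m I it contributes nothing, and the constant terms of the other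
    cofactors form [D]. *)
Lemma jac_mx_left_inverse f : primitive f ->
  (forall j, ext_jacobian_ideal f (mono (b j))) -> exists D, D *m jac_mx f = 1%:M.
Proof.
move=> fp hJ; have [G [_ GE]] := primitive_deriv_split fp.
have [m [_ m0 mE]] := primitive_split fp.
have e j : exists H : ('I_n -> ps) * ps,
    mono (b j) = \sum_i H.1 i * pderiv i f + H.2 * f.
  by have [H [h0 HE]] := ext_jacobian_combination (hJ j); exists (H, h0).
pose H j := projT1 (cid (e j)); have HE j := projT2 (cid (e j)).
exists (\matrix_(j, i) (H j).1 i mi_zero); apply/matrixP => j l; rewrite !mxE.
transitivity (mono (b j) (b l)).
  rewrite {1}(HE j) pcoefD pcoef_sum -/(H j).
  have fE q : (q * f) (b l) = 0 by rewrite mE coef_at_generatorM m0 mulr0.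
  rewrite fE addr0; apply: eq_bigr => i _.
  by rewrite !mxE GE coef_at_generatorM coef_at_generator.
rewrite /Defs.mono; congr (_ %:R); congr nat_of_bool; apply/eqP/eqP => [jl|->//].
by apply: b_anti; rewrite jl mi_le_refl.
Qed.

(** Since [h] is in m I and I is generated by the derivatives of [g], the field [a] can be chosen to
    vanish at the origin; the derivatives of [h] lie in I, which gives the matrix [Cm]. *)
Lemma primitive_deform g h D : primitive g -> D *m jac_mx g = 1%:M -> primitive h ->
  exists2 e : R, 0 < e & forall s : C, cmod s <= e -> right_equiv g (g + pC s * h).
Proof.
move=> gp hD hp; have [H [Hc HE]] := generators_from_jacobian gp hD.
have [m [mc m0 mE]] := primitive_split hp.
have [K [Kc KE]] := primitive_deriv_split hp.
have [gc _ _] := gp.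
apply: (@right_equiv_deform _ _ g h (fun i => \sum_j m j * H j i)
  (fun i l => \sum_j K i j * H j l)) => //.
- by move=> i; apply: rpred_sum => j _; rewrite rpredM.
- by move=> i l; apply: rpred_sum => j _; rewrite rpredM.
- by move=> i; rewrite pcoef_sum big1// => j _; rewrite pcoefM0 m0 mul0r.
- rewrite {1}mE; under [RHS]eq_bigr do rewrite mulr_suml.
  rewrite exchange_big; apply: eq_bigr => j _ /=.
  by rewrite HE mulr_suml; apply: eq_bigr => i _; ring.
- move=> i; rewrite KE; under [RHS]eq_bigr do rewrite mulr_suml.
  rewrite exchange_big; apply: eq_bigr => j _ /=.
  by rewrite HE mulr_suml; apply: eq_bigr => l _; ring.
Qed.
End MonomialIdeal.

(** * Deformations with constant Jacobian ideal *)

(** At the supremum s of the initial segments on which [Q] holds, one direction of the local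
    equivalence carries [Q] to s and the other carries it beyond s. *)
Lemma unit_interval_connected (R : realType) (Q : R -> Prop) :
  (forall x, 0 <= x <= 1 -> exists2 e, 0 < e &
     forall y, 0 <= y <= 1 -> `|y - x| < e -> (Q y <-> Q x)) ->
  Q 0 -> Q 1.
Proof.
move=> hloc Q0.
pose A := [set x : R | 0 <= x <= 1 /\ forall y, 0 <= y <= x -> Q y]%classic.
have A0 : A 0.
  split; first by lra.
  by move=> y hy; have -> : y = 0 by lra.
have supA : has_sup A by split; [exists 0 | exists 1 => x [hx _]; lra].
set s := sup A.
have s0 : 0 <= s by apply: ub_le_sup => //; case: supA.
have s1 : s <= 1 by apply: ge_sup; [case: supA | move=> x [hx _]; lra].
have [|e e0 he] := hloc s; first by lra.
have [x [hx xQ] xs] := sup_adherent e0 supA; rewrite -/s in xs.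
have xles : x <= s by apply: ub_le_sup; [case: supA | split].
have Qs : Q s.
  apply/(he x); [lra| by rewrite ltr_norml; lra | apply: xQ; lra].
have Qnear y : 0 <= y <= 1 -> y < s + e -> Q y.
  move=> hy hye; case: (leP y x) => hyx; first by apply: xQ; lra.
  by apply/(he y) => //; rewrite ltr_norml; lra.
case: (ltP 1 (s + e)) => hs; first by apply: Qnear; lra.
have : A (s + e / 2).
  split; first by lra.
  by move=> y hy; apply: Qnear; lra.
by move=> hA; have := ub_le_sup supA.2 hA; rewrite -/s; lra.
Qed.

Section Path.
Variables (R : realType) (n : nat).
Local Notation C := (R[i]).
Local Notation ps := (ps R n).

(* Finitely many roots cannot block all the parabolic arcs
   [x + i m x (1 - x)], which only meet at their endpoints. *)
Definition arc (m : nat) (x : R) : C := (x +i* (m%:R * (x * (1 - x))))%C.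

Lemma arc_avoids_roots (P : {poly C}) : P != 0 -> exists m : nat,
  forall x, 0 < x < 1 -> ~~ root P (arc m x).
Proof.
move=> P0; apply: contrapT => hn.
have bad m : exists x, 0 < x < 1 /\ root P (arc m x).
  apply: contrapT => hm; apply: hn; exists m => x hx.
  by apply/negP => hr; apply: hm; exists x.
pose x m := projT1 (cid (bad m)); have xP m := projT2 (cid (bad m)).
(* One bad point on each of [size P] arcs: these are distinct roots, one more than the degree
   allows. *)
pose rs := [seq arc m (x m) | m <- iota 0 (size P)].
suff : (size rs < size P)%N by rewrite size_map size_iota ltnn.
apply: max_poly_roots => //.
  by apply/allP => _ /mapP[m _ ->]; case: (xP m).
rewrite map_inj_uniq ?iota_uniq// => m m' [xx].
rewrite xx => /mulIf h; apply/eqP; rewrite -(eqr_nat R); apply/eqP/h.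
by have [hx _] := xP m'; rewrite -/(x m') in hx; rewrite mulf_neq0//; lra.
Qed.

Lemma arc_lipschitz m (x y : R) : 0 <= x <= 1 -> 0 <= y <= 1 ->
  cmod (arc m y - arc m x) <= (1 + m%:R) * `|y - x|.
Proof.
move=> hx hy; apply: le_trans (cmod_le_ReIm _) _; rewrite mulrDl mul1r /arc/=.
rewrite lerD2l -mulrBr.
have -> : y * (1 - y) - x * (1 - x) = (1 - x - y) * (y - x) by ring.
rewrite normrM ger0_norm// ler_wpM2l// normrM ler_piMl// ler_norml; lra.
Qed.

Variables (k : nat) (b : 'I_k -> mi n).
Hypothesis b_anti : forall i j, mi_le (b i) (b j) -> i = j.

Lemma det_line (M : 'M[C]_k) : exists2 P : {poly C},
  P.[0] = 1 & forall t, P.[t] = \det (1%:M + t *: M).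
Proof.
pose P := \det (1%:M + 'X *: map_mx (@polyC C) M).
have PE t : P.[t] = \det (1%:M + t *: M).
  rewrite -[_.[_]]/(horner_eval t P) -det_map_mx; congr (\det _).
  apply/matrixP => i j; rewrite !mxE /= /horner_eval.
  by rewrite !hornerE hornerMn hornerE.
by exists P => //; rewrite PE scale0r addr0 det1.
Qed.

Lemma primitive_right_equiv (f p : ps) D D' :
  primitive b f -> primitive b p ->
  D *m jac_mx b f = 1%:M -> D' *m jac_mx b p = 1%:M -> right_equiv f p.
Proof.
move=> fp pp hD hD'; pose h := p - f.
have hp : primitive b h.
  have -> : h = p + pC (-1) * f by rewrite pCN pC1 mulN1r.
  by apply: primitiveD => //; apply: primitiveZ.
pose F (t : C) := f + pC t * h.
have Fp t : primitive b (F t) by apply: primitiveD => //; apply: primitiveZ.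
have FJ t : jac_mx b (F t) = jac_mx b f + t *: jac_mx b h by rewrite jac_mxD jac_mxZ.
(* Off the roots of [P], the product of [D] with the Jacobian matrix of [F t] is invertible. *)
have [P P0 PE] := det_line (D *m jac_mx b h).
have Pn0 : P != 0.
  by apply/eqP => PZ; move: P0; rewrite PZ horner0 => /esym/eqP; rewrite oner_eq0.
have [m hm] := arc_avoids_roots Pn0.
have F0 : F 0 = f by rewrite /F pC0 mul0r addr0.
have F1 : F 1 = p by rewrite /F pC1 mul1r /h addrC subrK.
(* The arc avoids the roots only in its interior, and [P] may vanish at 1; the endpoints are served
   by [D] and [D'] themselves. *)
have good x : 0 <= x <= 1 -> exists E, E *m jac_mx b (F (arc m x)) = 1%:M.
  move=> hx; have [x0|x0] := eqVneq x 0.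
    have -> : arc m x = 0 by rewrite /arc x0 mul0r mulr0.
    by rewrite F0; exists D.
  have [x1|x1] := eqVneq x 1.
    have -> : arc m x = 1 by rewrite /arc x1 subrr !mulr0.
    by rewrite F1; exists D'.
  have hr : ~~ root P (arc m x) by apply: hm; lra.
  rewrite /root PE in hr.
  have hu : 1%:M + arc m x *: (D *m jac_mx b h) \in unitmx by rewrite unitmxE unitfE.
  exists (invmx (1%:M + arc m x *: (D *m jac_mx b h)) *m D).
  by rewrite -mulmxA FJ mulmxDr hD -scalemxAr mulVmx.
pose Q x := right_equiv f (F (arc m x)).
suff : Q 1.
  have -> : Q 1 = right_equiv f (F 1) by rewrite /Q /arc subrr !mulr0.
  by rewrite F1.
apply: unit_interval_connected; last first.
  have -> : Q 0 = right_equiv f (F 0) by rewrite /Q /arc mul0r mulr0.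
  by rewrite F0; exact: right_equiv_refl.
move=> x hx; have [E hE] := good x hx.
have [e e0 he] := primitive_deform b_anti (Fp _) hE hp.
have m1 : 0 < 1 + m%:R :> R by rewrite addrC natr1 ltr0n.
exists (e / (1 + m%:R)); first by rewrite divr_gt0.
move=> y hy; rewrite ltr_pdivlMr// mulrC => hyx.
have FE : F (arc m y) = F (arc m x) + pC (arc m y - arc m x) * h.
  by rewrite /F pCD pCN; ring.
have hxy : right_equiv (F (arc m x)) (F (arc m y)).
  rewrite FE; apply: he; apply: le_trans (arc_lipschitz m hx hy) _; exact: ltW.
split=> hQ; apply: right_equiv_trans hQ _ => //.
by apply: right_equiv_sym hxy; have [] := Fp (arc m x).
Qed.
End Path.

(** * Finite antichains of generators, and the ideal of a Thom-Sebastiani polynomial *)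

Section Reduction.
Variables (R : realType) (n : nat).
Local Notation ps := (ps R n).
Local Notation mono := (@mono R n).

Lemma minimal_below (s : seq (mi n)) a : a \in s ->
  exists c, [/\ c \in s, mi_le c a & forall d, d \in s -> mi_le d c -> d = c].
Proof.
have [m] := ubnP (mdegree a); elim: m a => // m IH a am ha.
case: (pselect (exists2 d, d \in s & mi_le d a /\ d != a)) => [[d ds [da dna]]|hn].
  have [|//|c [cs cd cmin]] := IH d.
    rewrite -ltnS; apply: leq_trans am; rewrite ltnS ltnNge.
    by apply/negP => /(mi_le_eqdeg da) E; rewrite E eqxx in dna.
  by exists c; split=> //; exact: mi_le_trans cd da.
exists a; split=> // [|d ds da]; first exact: mi_le_refl.
by apply/eqP/negPn/negP => dna; apply: hn; exists d.
Qed.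

Lemma mideal_finite (S : mi n -> Prop) (x : ps) :
  ideal_gen (fun m => exists b, S b /\ m = mono b) x ->
  exists s : seq (mi n), (forall b, b \in s -> S b) /\
    ideal_gen (fun m => exists2 b, b \in s & m = mono b) x.
Proof.
move=> /ideal_genE[k [h [g [H ->]]]].
have e j : exists b, S b /\ g j = mono b by have [_ [b hb]] := H j; exists b.
pose bb j := projT1 (cid (e j)); have bP j := projT2 (cid (e j)).
exists [seq bb j | j <- enum 'I_k]; split.
  by move=> _ /mapP[j _ ->]; have [] := bP j.
apply/ideal_genE; exists k, h, g; split=> // j; have [h1 _] := H j; split=> //.
by exists (bb j); [rewrite map_f// mem_enum | have [] := bP j].
Qed.

(** Finiteness comes from the generators [f] and its [n] derivatives, each of which involves
    finitely many members of [S]; the minimal exponents among these form the antichain. *)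
Lemma ext_jacobian_basis (f : ps) (S : mi n -> Prop) :
  (forall x, ext_jacobian_ideal f x <->
     ideal_gen (fun m => exists b, S b /\ m = mono b) x) ->
  exists k (b : 'I_k -> mi n), (forall i j, mi_le (b i) (b j) -> i = j) /\
    forall x, ext_jacobian_ideal f x <-> mideal b x.
Proof.
move=> hS; pose gen (o : option 'I_n) := if o is Some i then pderiv i f else f.
have hgen o : exists s : seq (mi n), (forall b, b \in s -> S b) /\
    ideal_gen (fun m => exists2 b, b \in s & m = mono b) (gen o).
  apply: mideal_finite; apply/hS; apply: ideal_gen_incl.
  by case: o => [i|]; [right; exists i | left].
pose s := flatten [seq projT1 (cid (hgen o)) | o <- enum {: option 'I_n}].
have sP o c : c \in projT1 (cid (hgen o)) -> c \in s.
  by move=> hc; apply/flattenP; exists (projT1 (cid (hgen o))) => //; rewrite map_f// mem_enum.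
have sS c : c \in s -> S c.
  move=> /flattenP[_ /mapP[o _ ->]] hc.
  by have [h _] := projT2 (cid (hgen o)); exact: h.
pose t := undup [seq c <- s | all (fun d => mi_le d c ==> (d == c)) s].
have tP c : c \in t <-> c \in s /\ forall d, d \in s -> mi_le d c -> d = c.
  rewrite mem_undup mem_filter; split=> [/andP[/allP h1 h2]|[h1 h2]].
    by split=> // d hd hdc; have := h1 d hd; rewrite hdc => /eqP.
  by rewrite h1 andbT; apply/allP => d hd; apply/implyP => /(h2 d hd) ->.
pose b := tnth (in_tuple t).
have bt j : b j \in t by exact: mem_tnth.
exists (size t), b; split.
  move=> i j hij; have [si _] := (tP _).1 (bt i); have [_ mj] := (tP _).1 (bt j).
  have := mj _ si hij; rewrite /b !(tnth_nth mi_zero)/= => /eqP.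
  by rewrite nth_uniq ?undup_uniq// => /eqP/val_inj.
have mono_s c : c \in s -> mideal b (mono c).
  move=> /minimal_below[d [ds dc dmin]].
  have /tnthP[j dE] : d \in in_tuple t by apply/tP.
  rewrite -(mi_subK dc) -monoM; apply: ideal_genM; first exact: conv_mono.
  by apply: ideal_gen_incl; exists j; rewrite dE.
move=> x; split.
  apply: ideal_gen_min => g hg.
  have [o ->] : exists o, g = gen o by case: hg => [->|[i ->]]; [exists None | exists (Some i)].
  have [_] := projT2 (cid (hgen o)); apply: ideal_gen_min => m [c hc ->].
  by apply: mono_s; exact: sP hc.
move=> hx; apply/hS; move: hx; apply: ideal_gen_min => m [j ->].
apply: ideal_gen_incl; exists (b j); split=> //; apply: sS.
by have [] := (tP _).1 (bt j).
Qed.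

(** Each variable occurs in at most one monomial, so every nonzero partial derivative is a scalar
    times a single monomial, and these already divide the monomials of [p]. *)
Lemma thom_sebastiani_ideal k (al : 'I_k -> mi n) (p : ps) :
  (forall j, al j != mi_zero) ->
  (forall j j', j != j' -> [disjoint mi_support (al j) & mi_support (al j')]) ->
  p = \sum_j mono (al j) ->
  forall x, ext_jacobian_ideal p x <->
    ideal_gen (fun m => exists b, (exists j i, (0 < al j i)%N /\
       b = mi_sub (al j) (mi_unit i)) /\ m = mono b) x.
Proof.
move=> al0 dis pE x.
have dp i : pderiv i p = \sum_j pC (al j i)%:R * mono (mi_sub (al j) (mi_unit i)).
  by rewrite pE raddf_sum/=; apply: eq_bigr => j _; rewrite pderiv_mono.
split; apply: ideal_gen_min => g.
  move=> [->|[i ->]].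
    rewrite pE; apply: ideal_gen_sum => j; have [i hi] := mi_neq0P (al0 j).
    have hle : mi_le (mi_unit i) (al j) by rewrite mi_leU.
    rewrite -(mi_subK hle) mi_addC -monoM; apply: ideal_genM; first exact: conv_mono.
    by apply: ideal_gen_incl; exists (mi_sub (al j) (mi_unit i)); split=> //; exists j, i.
  rewrite dp; apply: ideal_gen_sum => j; case: (posnP (al j i)) => [->|hi].
    by rewrite pC0 mul0r; exact: ideal_gen0.
  apply: ideal_genM; first exact: conv_pC.
  by apply: ideal_gen_incl; exists (mi_sub (al j) (mi_unit i)); split=> //; exists j, i.
move=> [c [[j [i [hi ->]]] ->]].
have -> : mono (mi_sub (al j) (mi_unit i)) = pC (al j i)%:R^-1 * pderiv i p.
  rewrite dp (bigD1 j)//= big1 ?addr0.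
    by rewrite mulrA -pCM mulVf ?pC1 ?mul1r// pnatr_eq0 -lt0n.
  move=> j' jj'; have := dis j' j jj'.
  rewrite disjoint_sym => /pred0P/(_ i); rewrite /= !inE -lt0n hi/= => /negbFE/eqP ->.
  by rewrite pC0 mul0r.
apply: ideal_genM; first exact: conv_pC.
by apply: ideal_gen_incl; right; exists i.
Qed.
End Reduction.

(** * Combinatorics of the exponents *)

(* The Kronecker symbols of [mi_unitE] are abstracted to arbitrary booleans for [lia]. *)
Ltac blia :=
  repeat match goal with H : context[nat_of_bool _] |- _ => move: H end;
  move=> /=;
  repeat match goal with |- context [nat_of_bool ?x] => case: x; move=> /= end;
  lia.

Section Exchange.
Local Open Scope nat_scope.
Variables (n k : nat) (b : 'I_k -> mi n) (sigma : 'I_k -> 'I_n).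
Local Notation e := (@mi_unit n).
Hypothesis b_anti : forall i j, mi_le (b i) (b j) -> i = j.
Hypothesis sigma_inj : injective sigma.

(** The condition that [primitive] imposes on a single exponent of a series. *)
Definition stays_up (al : mi n) :=
  forall i, 0 < al i -> exists j, mi_le (b j) (mi_sub al (e i)).

Hypothesis sigma_up : forall j, stays_up (mi_add (b j) (e (sigma j))).

Lemma b_inj : injective b.
Proof. by move=> i j h; apply: b_anti; rewrite h mi_le_refl. Qed.

(* Pigeonhole: if no generator of [X] were matched with [i], then [sigma] would
   inject [j |: X] into the set of witnesses [c] of the members of [X]. *)
Lemma exchange j i : 0 < b j i ->
  exists j' c, sigma j' = i /\ mi_add (b j') (e i) = mi_add (b j) (e c).
Proof.
move=> bji; have [<-|nij] := eqVneq (sigma j) i; first by exists j, (sigma j).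
(* [W j' c] says that [b j'] arises below b j - e_i + e_c with the increase at c attained; c is then
   determined by j'. *)
pose W j' c := (b j' c == (b j c).+1) && mi_le (b j') (mi_add (mi_sub (b j) (e i)) (e c)).
have W_le j' c l : W j' c -> b j' l <= b j l - (l == i) + (l == c).
  by move=> /andP[_ /mi_leP/(_ l)]; rewrite !miE.
have W_ne j' c : W j' c -> c != i.
  move=> h; apply/eqP => ci; have := W_le _ _ c h.
  by move: h => /andP[/eqP -> _]; rewrite ci !eqxx; blia.
have W_uniq j' c c' : W j' c -> W j' c' -> c = c'.
  move=> h /andP[/eqP h' _]; have := W_le _ _ c' h; rewrite h'.
  by have [->//|_] := eqVneq c' c; blia.
(* Lowering at c gives a generator below b j - e_i + e_a. If it did not attain the increase at a, it
   would lie below [b j], hence equal it, contradicting the decrease at i. *)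
have W_step j' a c : c != a -> a != i -> 0 < (mi_add (b j') (e a)) c ->
    stays_up (mi_add (b j') (e a)) ->
    (forall l, (mi_sub (mi_add (b j') (e a)) (e c)) l <= b j l - (l == i) + (l == a)) ->
    exists j'', W j'' a.
  move=> ca ai hc /(_ c hc)[j'' /mi_leP hj''] hle; exists j''.
  have up l := leq_trans (hj'' l) (hle l).
  apply/andP; split; last by apply/mi_leP => l; rewrite !miE.
  have := up a; rewrite eqxx (negPf ai) subn0 addn1 leq_eqVlt => /orP[//|ha].
  have jE : j'' = j.
    apply: b_anti; apply/mi_leP => l; have [->|la] := eqVneq l a; first by rewrite -ltnS.
    by have := up l; rewrite (negPf la); blia.
  by have := up i; rewrite jE eqxx eq_sym (negPf ai); blia.
pose X := [set j' | [exists c, W j' c]].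
have [[j' jX ji]|hn] := pselect (exists2 j', j' \in X & sigma j' = i).
  move: jX; rewrite inE => /existsP[c hW]; exists j', c; split=> //.
  have ci := W_ne _ _ hW; have /eqP Wc : b j' c == (b j c).+1 by case/andP: hW.
  have hc : 0 < (mi_add (b j') (e i)) c by rewrite !miE Wc.
  have up := @sigma_up j'; rewrite ji in up; have [j2 /mi_leP h2] := up c hc.
  have j2E : j2 = j.
    apply: b_anti; apply/mi_leP => l; apply: leq_trans (h2 l) _; rewrite !miE.
    by have := W_le _ _ l hW; have [->|] := eqVneq l i; blia.
  apply/ffunP => l; have := h2 l; have := W_le _ _ l hW; rewrite j2E !miE.
  have [->|li] := eqVneq l i; first by rewrite eq_sym (negPf ci); blia.
  by have [->|lc] := eqVneq l c; rewrite ?Wc; blia.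
have jX : j \notin X.
  by rewrite inE; apply/existsPn => c; apply/negP => /andP[/eqP h _]; blia.
pose w j' := odflt (sigma j) [pick c | W j' c].
suff sub : sigma @: (j |: X) \subset w @: X.
  have := leq_trans (subset_leq_card sub) (leq_imset_card w X).
  by rewrite card_imset// cardsU1 jX add1n ltnn.
have in_w a j' : W j' a -> a \in w @: X.
  move=> h; apply/imsetP; exists j'; first by rewrite inE; apply/existsP; exists a.
  by rewrite /w; case: pickP => [c hc|/(_ a)]; [exact: W_uniq h hc | rewrite h].
apply/fintype.subsetP => _ /imsetP[j' /setU1P[->|jX'] ->].
  have [||||l|j'' hj''] := W_step j (sigma j) i.
  - by rewrite eq_sym.
  - by [].
  - by rewrite !miE; blia.
  - exact: sigma_up.
  - by rewrite !miE; have [->|li] := eqVneq l i; blia.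
  - exact: in_w hj''.
have ai : sigma j' != i by apply/eqP => h; apply: hn; exists j'.
move: (jX'); rewrite inE => /existsP[c hW].
have [ca|ca] := eqVneq c (sigma j'); first by apply: (@in_w _ j'); rewrite -ca.
have /eqP Wc : b j' c == (b j c).+1 by case/andP: hW.
have [||||l|j'' hj''] := W_step j' (sigma j') c.
- by [].
- by [].
- by rewrite !miE Wc.
- exact: sigma_up.
- by rewrite !miE; have := W_le _ _ l hW; have [->|li] := eqVneq l c; blia.
- exact: in_w hj''.
Qed.

Definition linear_exponent j := [exists i, b j == e i].

Lemma exchange_nonlinear j i : 0 < b j i -> b j != e i ->
  exists j', sigma j' = i /\ mi_add (b j') (e i) = mi_add (b j) (e (sigma j)).
Proof.
move=> bji bj; have [j1 [c [s1 E1]]] := exchange bji.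
have at1 l : b j1 l + (l == i) = b j l + (l == c).
  by have := congr1 (fun a : mi n => a l) E1; rewrite !miE.
have [ci|ci] := eqVneq c i.
  have jE : j1 = j by apply: b_inj; apply/ffunP => l; have := at1 l; rewrite ci; blia.
  by exists j; rewrite -jE s1.
have b1c : 0 < b j1 c by have := at1 c; rewrite eqxx (negPf ci); blia.
have [j2 [c' [s2 E2]]] := exchange b1c.
have at2 l : b j2 l + (l == c) = b j1 l + (l == c').
  by have := congr1 (fun a : mi n => a l) E2; rewrite !miE.
have c'c : c' != c.
  apply/eqP => c'c; suff jE : j2 = j1 by move: ci; rewrite -s2 jE s1 eqxx.
  by apply: b_inj; apply/ffunP => l; have := at2 l; rewrite c'c; blia.
have [c'i|c'i] := eqVneq c' i.
  exists j1; rewrite s1; split=> //; suff -> : sigma j = c by [].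
  rewrite -s2; congr sigma; apply: b_inj; apply/ffunP => l.
  by have := at1 l; have := at2 l; rewrite c'i; blia.
have [m hm] : exists m, 0 < (mi_sub (b j) (e i)) m.
  apply: mi_neq0P; apply: contra bj => /eqP h; apply/eqP.
  have hi : mi_le (e i) (b j) by rewrite mi_leU.
  by rewrite -(mi_subK hi) h mi_add0.
rewrite !miE in hm.
have m0 : 0 < b j m by blia.
have m1 : 0 < b j1 m by have := at1 m; blia.
have m2 : 0 < b j2 m by have := at2 m; have := at1 m; blia.
have [l0 [x [t0 X0]]] := exchange m0.
have [l1 [y [t1 field1]]] := exchange m1.
have [l2 [z [t2 X2]]] := exchange m2.
have l10 : l1 = l0 by apply: sigma_inj; rewrite t0 t1.
have l20 : l2 = l0 by apply: sigma_inj; rewrite t0 t2.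
rewrite l10 in field1; rewrite l20 in X2.
have eq1 l : b j l + (l == x) = b j1 l + (l == y).
  by have := congr1 (fun a : mi n => a l) (etrans (esym X0) field1); rewrite !miE.
have eq2 l : b j l + (l == x) = b j2 l + (l == z).
  by have := congr1 (fun a : mi n => a l) (etrans (esym X0) X2); rewrite !miE.
have xc : c = x.
  apply/eqP; have := eq1 c; have := at1 c; rewrite eqxx (negPf ci).
  by case: (c == x) => //=; blia.
have xc' : c' = x.
  apply/eqP; have := eq2 c'; have := at2 c'; have := at1 c'.
  by rewrite eqxx (negPf c'i) (negPf c'c); case: (c' == x) => //=; blia.
by rewrite xc xc' eqxx in c'c.
Qed.

(** Linear generators are squared because their matched exponents may overlap without being equal:
    for e_1, e_2, e_3 a cyclic [sigma] gives x_1 x_2, x_2 x_3, x_3 x_1. *)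
Definition ts_exponent j :=
  if linear_exponent j then mi_add (b j) (b j) else mi_add (b j) (e (sigma j)).

Lemma linearP j : reflect (exists i, b j = e i) (linear_exponent j).
Proof. by apply: (iffP existsP) => -[i /eqP h]; exists i; rewrite ?h. Qed.

Lemma ts_exponent_up j : stays_up (ts_exponent j).
Proof.
rewrite /ts_exponent; case: ifP => [/linearP[i bi] l|_]; last exact: sigma_up.
move=> hl; exists j; move: hl; rewrite bi !miE.
by have [->|] := eqVneq l i => //= _; rewrite mi_addK mi_le_refl.
Qed.

Lemma ts_exponent_covers j :
  exists2 i, 0 < ts_exponent j i & mi_sub (ts_exponent j) (e i) = b j.
Proof.
rewrite /ts_exponent; case: ifP => [/linearP[i bi]|_].
  by exists i; rewrite bi ?miE ?eqxx// mi_addK.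
by exists (sigma j); rewrite ?miE ?eqxx ?addn1// mi_addK.
Qed.

Lemma nonlinear_exponent j i : ~~ linear_exponent j -> 0 < mi_add (b j) (e (sigma j)) i ->
  exists j', sigma j' = i /\ mi_add (b j') (e i) = mi_add (b j) (e (sigma j)).
Proof.
move=> nl; rewrite !miE; have [-> _|ni hi] := eqVneq i (sigma j); first by exists j.
apply: exchange_nonlinear; first by rewrite addn0 in hi.
by apply: contra nl => /eqP h; apply/linearP; exists i.
Qed.

(** By the antichain property e_i is the only generator involving x_i. If sigma j' = i, exchanging
    at a variable l of [b j'] produces a generator involving x_i, hence e_i, and then [b j'] would
    be e_l. *)
Lemma linear_nonlinear_disjoint j j' i : b j = e i -> ~~ linear_exponent j' ->
  mi_add (b j') (e (sigma j')) i = 0.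
Proof.
move=> bj nl.
have meets l : 0 < b l i -> l = j.
  by move=> h; apply/esym/b_anti; rewrite bj mi_leU.
have jj' : j' != j by apply: contra nl => /eqP ->; apply/linearP; exists i.
have b'i : b j' i = 0.
  by apply/eqP; rewrite eqn0Ngt; apply/negP => /meets h; rewrite h eqxx in jj'.
rewrite !miE b'i add0n; apply/eqP; rewrite eqb0; apply/eqP => si.
have [l hl] : exists l, 0 < b j' l.
  apply: mi_neq0P; apply/eqP => h; move: jj'.
  by rewrite (b_anti (i := j') (j := j)) ?eqxx// h mi_le0.
have nli : b j' != e l by apply: contra nl => /eqP h; apply/linearP; exists l.
have [j1 [s1 E1]] := exchange_nonlinear hl nli.
have li : i != l by apply/eqP => h; rewrite -h b'i in hl.
have at1 m : b j1 m + (m == l) = b j' m + (m == i).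
  by have := congr1 (fun a : mi n => a m) E1; rewrite -si !miE.
have j1E : j1 = j by apply: meets; have := at1 i; rewrite eqxx (negPf li); blia.
case/eqP: nli; apply/ffunP => m; have := at1 m; rewrite j1E bj !miE; blia.
Qed.

(** A nonlinear exponent containing x_i equals b_l + e_i for the generator l matched with i, so it
    is determined by i. *)
Lemma ts_exponent_disjoint j j' i :
  0 < ts_exponent j i -> 0 < ts_exponent j' i -> ts_exponent j = ts_exponent j'.
Proof.
rewrite /ts_exponent.
case: ifP => [/linearP[a ba]|/negbT nl]; case: ifP => [/linearP[a' ba']|/negbT nl'].
- rewrite ba ba' !miE; have [->|//] := eqVneq i a; have [->|//] := eqVneq a a'; by [].
- rewrite ba !miE; have [->|//] := eqVneq i a => _.
  by have := linear_nonlinear_disjoint ba nl'; rewrite !miE => ->.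
- rewrite ba' !miE; have [->|] := eqVneq i a'; last by [].
  by have := linear_nonlinear_disjoint ba' nl; rewrite !miE => ->.
move=> /(nonlinear_exponent nl)[l [sl <-]] /(nonlinear_exponent nl')[l' [sl' <-]].
by congr (mi_add (b _) _); apply: sigma_inj; rewrite sl sl'.
Qed.
End Exchange.

Lemma left_inverse_matching (F : fieldType) n k (M : 'M[F]_(n, k)) D :
  D *m M = 1%:M -> exists2 s : 'I_k -> 'I_n, injective s & forall j, M (s j) j != 0.
Proof.
move=> hD; have fM : row_full M by apply/row_fullP; exists D.
pose f := fullrankfun fM; pose N := rowsub f M.
have hN : \det N != 0 by rewrite -unitfE -unitmxE fullrowsub_unit.
(* A nonzero determinant has a nonzero term in its expansion over permutations. *)
have [s hs] : exists s : 'S_k, forall i, N i (s i) != 0.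
  apply: contrapT => hn; case/eqP: hN; rewrite /determinant big1// => s _.
  have [i hi] : exists i, N i (s i) == 0.
    apply: contrapT => hi; apply: hn; exists s => i; apply/negP => h.
    by apply: hi; exists i.
  by rewrite (bigD1 i)//= (eqP hi) mul0r mulr0.
exists (fun j => f (s^-1%g j)).
  by apply: inj_comp; [exact: fullrankfun_inj | exact: perm_inj].
by move=> j; have := hs (s^-1%g j); rewrite permKV mxE.
Qed.

(** * The two directions of the equivalence *)

Section Main.
Variables (R : realType) (n : nat).
Local Notation ps := (ps R n).

Lemma monomial_jacobian_right_equiv (f : ps) k (b : 'I_k -> mi n) :
  f \in conv -> f <> 0 -> f mi_zero = 0 ->
  (forall i j, mi_le (b i) (b j) -> i = j) ->
  (forall x, ext_jacobian_ideal f x <-> mideal b x) ->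
  exists p, thom_sebastiani p /\ right_equiv f p.
Proof.
move=> fc f0 fz b_anti hJ.
have fJ : mideal b f by apply/hJ; apply: ideal_gen_incl; left.
have fp : primitive b f.
  by apply/(primitive_pderiv b fc fz) => i; apply/hJ; apply: ideal_gen_incl; right; exists i.
have gens (g : ps) : (forall x, ext_jacobian_ideal g x <-> mideal b x) ->
    forall j, ext_jacobian_ideal g (mono R (b j)).
  by move=> h j; apply/h; apply: ideal_gen_incl; exists j.
have [D hD] := jac_mx_left_inverse b_anti fp (gens f hJ).
have [s s_inj hs] := left_inverse_matching hD.
have s_up j : stays_up b (mi_add (b j) (mi_unit (s j))).
  move=> i hi; have [_ _] := fp; apply; last exact: hi.
  by have := hs j; rewrite mxE /pderiv mulf_eq0 negb_or => /andP[].
pose al := ts_exponent b s.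
(* Several generators may give the same exponent: both xy and x^2 come from x^2 y. *)
pose t := undup [seq al j | j <- enum 'I_k].
have tP a : a \in t -> exists j, a = al j.
  by rewrite mem_undup => /mapP[j _ ->]; exists j.
have alt j : al j \in t by rewrite mem_undup map_f// mem_enum.
pose be := tnth (in_tuple t).
have beP l : exists j, be l = al j by apply: tP; exact: mem_tnth.
have be_alt j : exists l, be l = al j.
  by have /tnthP[l hl] := alt j : al j \in in_tuple t; exists l.
(* Without generators the ideal, and with it [f], would be zero; [p] needs at least one monomial. *)
have k0 : (0 < k)%N.
  rewrite lt0n; apply/eqP => k0; apply: f0; apply: psP => a; apply/eqP/negPn/negP => fa.
  by have [[j jk] _] := mideal_coef fJ fa; move: (jk); rewrite k0.
have be0 l : be l != mi_zero.
  have [j ->] := beP l; have [i hi _] := ts_exponent_covers b s j.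
  by apply/eqP => h; move: hi; rewrite -/(al j) h miE.
have dis l l' : l != l' -> [disjoint mi_support (be l) & mi_support (be l')].
  move=> ll'; rewrite finset.disjoints_subset; apply/fintype.subsetP => i; rewrite !inE negbK -lt0n => h1.
  rewrite eqn0Ngt; apply/negP => h2; case/negP: ll'.
  have [j jE] := beP l; have [j' jE'] := beP l'.
  rewrite jE in h1; rewrite jE' in h2.
  have := ts_exponent_disjoint b_anti s_inj s_up h1 h2.
  rewrite -/(al j) -/(al j') -jE -jE' /be !(tnth_nth mi_zero)/= => /eqP.
  by rewrite nth_uniq ?undup_uniq.
pose p : ps := \sum_l mono R (be l).
have pJ x : ext_jacobian_ideal p x <-> mideal b x.
  rewrite (thom_sebastiani_ideal be0 dis erefl); split; apply: ideal_gen_min => m.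
    move=> [c [[l [i [hi ->]]] ->]]; have [j jE] := beP l; rewrite jE in hi *.
    have [j' hj'] := ts_exponent_up s_up hi.
    rewrite -(mi_subK hj') -monoM; apply: ideal_genM; first exact: conv_mono.
    by apply: ideal_gen_incl; exists j'.
  move=> [j ->]; apply: ideal_gen_incl; exists (b j); split=> //.
  have [l lE] := be_alt j; have [i hi hE] := ts_exponent_covers b s j.
  by exists l, i; rewrite lE.
have pc : p \in conv by apply: rpred_sum => l _; exact: conv_mono.
have pz : p mi_zero = 0.
  by rewrite /p pcoef_sum big1// => l _; rewrite /mono eq_sym (negPf (be0 l)).
have pp : primitive b p.
  by apply/(primitive_pderiv b pc pz) => i; apply/pJ; apply: ideal_gen_incl; right; exists i.
have [D' hD'] := jac_mx_left_inverse b_anti pp (gens p pJ).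
have fpE := primitive_right_equiv b_anti fp pp hD hD'.
exists p; split; last exact: fpE.
exists (size t), be; split; last by split=> //; split=> //; rewrite psumE.
by have := alt (Ordinal k0); case: (t).
Qed.
End Main.

Unset Implicit Arguments.

Theorem theorem1p10 (R : realType) (n : nat) (f : ps R n) :
  convergent f -> f <> @pzero R n -> f (@mi_zero n) = 0 ->
  (monomial_ideal (ext_jacobian_ideal f) <->
   exists p, thom_sebastiani p /\ right_equiv f p).
Proof.
move=> /convergentE fc f0 fz; split.
  (* Pulling [f] back along [phi] gives [g], whose ideal is generated by monomials in the standard
     coordinates. *)
  move=> [phi [hphi [S hS]]]; have [g gc gE] := aut_surj hphi fc.
  have [psi hpsi psiK] := aut_inverse hphi.
  have gz : g mi_zero = 0 by rewrite -(psiK g gc).1 gE (aut_local hpsi).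
  have g0 : g <> 0 by move=> h; apply: f0; rewrite -gE h (aut0 hphi).
  have Sconv q : ideal_gen (fun m => exists b, S b /\ m = mono R b) q -> q \in conv.
    by apply: ideal_gen_conv => m [b [_ ->]]; exact: conv_mono.
  have gJ x : ext_jacobian_ideal g x <-> ideal_gen (fun m => exists b, S b /\ m = mono R b) x.
    split=> hx.
      have : ext_jacobian_ideal f (phi x) by rewrite -gE; exact: aut_ext_jacobian.
      move=> /hS[q [hq /(aut_inj hphi (ext_jacobian_conv gc hx) (Sconv q hq)) ->//]].
    have /hS : exists q, ideal_gen (fun m => exists b, S b /\ m = mono R b) q /\ phi x = phi q.
      by exists x.
    rewrite -gE => /(ext_jacobian_aut _ hphi gc)[q [hq]].
    by move=> /(aut_inj hphi (Sconv x hx) (ext_jacobian_conv gc hq)) ->.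
  have [k [b [b_anti hb]]] := ext_jacobian_basis gJ.
  have [p [pTS gp]] := monomial_jacobian_right_equiv gc g0 gz b_anti hb.
  exists p; split=> //; apply: right_equiv_trans gp; apply: right_equiv_sym => //.
  by exists phi.
move=> [p [[k [al [k0 [al0 [dis pE]]]]] [phi [hphi fE]]]].
have [psi hpsi psiK] := aut_inverse hphi.
rewrite psumE in pE.
have pc : p \in conv by rewrite -fE; exact: aut_conv.
have pf : f = psi p by rewrite -fE (psiK f fc).1.
exists psi; split=> //.
(* Up to scalars these monomials are the nonzero partial derivatives of [p], carried to [f] by
   [psi]. *)
exists (fun b => exists j i, (0 < al j i)%N /\ b = mi_sub (al j) (mi_unit i)) => x.
rewrite pf (ext_jacobian_aut x hpsi pc).
by split=> -[q [hq ->]]; exists q; split=> //; apply/(thom_sebastiani_ideal al0 dis pE).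
Qed.
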